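(* Let $W:[0,1]^2\to[0,1]$ be a Riemann integrable graphon with $\sup_{x,y\in[0,1]}W(x,y)<1$. Let $\boldsymbol{G}\sim\mathcal{G}(n,W)$. Then, with high probability as $n\to\infty$, $$\chi(\boldsymbol{G})\le(\varphi(W)+o(1))\frac{n}{2\log n};$$ that is, for every fixed $\epsilon>0$, $\mathbb{P}\big(\chi(\boldsymbol{G})\le(\varphi(W)+\epsilon)\frac{n}{2\log n}\big)\to1$ as $n\to\infty$.
   Context: A graphon is a symmetric measurable function $W:[0,1]^2\to[0,1]$. The random graph $\mathcal{G}(n,W)$ has vertex set $[n]=\{1,\dots,n\}$: sample $X_1,\dots,X_n$ independently and uniformly from $[0,1]$; conditionally on these, each edge $ij$ ($i\ne j$) is present independently with probability $W(X_i,X_j)$. $\chi(G)$ is the chromatic number, $\log$ is the natural logarithm, $\lambda$ is the Lebesgue (uniform) measure on $[0,1]$. For a graphon $W$ with values in $[0,1)$ such that $\log\frac1{1-W}$ is integrable on $[0,1]^2$, $$\varphi(W):=\sup_{S\subseteq[0,1]:\ \lambda(S)>0}\frac1{\lambda(S)}\int_S\int_S\log\Big(\frac1{1-W(x,y)}\Big)\,dx\,dy,$$ the supremum being over measurable $S$ of positive measure. *)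

(* Defs.v *)
From mathcomp Require Import all_boot all_order all_algebra.
From mathcomp Require Import all_classical all_reals all_analysis.

Set Implicit Arguments.
Unset Strict Implicit.
Unset Printing Implicit Defensive.

Import Order.TTheory GRing.Theory Num.Theory.
Import numFieldNormedType.Exports.

Local Open Scope classical_set_scope.
Local Open Scope ring_scope.

(* Finite simple graphs on the vertex set 'I_n, encoded by their set of arcs:
   each edge ij occurs in both orientations. *)

Definition is_sgraph (n : nat) (E : {set 'I_n * 'I_n}) : bool :=
  [forall i, (i, i) \notin E] &&
  [forall i, forall j, ((i, j) \in E) == ((j, i) \in E)].

Definition sgraph (n : nat) : Type := {E : {set 'I_n * 'I_n} | is_sgraph E}.

Definition adj (n : nat) (G : sgraph n) (i j : 'I_n) : bool :=
  (i, j) \in val G.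

Definition colorable (n : nat) (G : sgraph n) (k : nat) : bool :=
  [exists c : {ffun 'I_n -> 'I_k},
    [forall i, forall j, adj G i j ==> (c i != c j)]].

Lemma ex_colorable (n : nat) (G : sgraph n) : exists k, colorable G k.
Proof.
exists n; apply/existsP; exists [ffun i => i].
apply/forallP => i; apply/forallP => j; apply/implyP; rewrite !ffunE.
case: eqVneq => // <-; rewrite /adj.
by case: G => E /= /andP[/forallP/(_ i)/negPf ->].
Qed.

Definition chromatic_number (n : nat) (G : sgraph n) : nat :=
  ex_minn (ex_colorable G).

(* Functions on [0,1]^2 are represented by total functions R -> R -> R whose
   values outside the unit square are irrelevant. *)

Definition graphon (R : realType) (W : R -> R -> R) : Prop :=
  [/\ measurable_fun (`[0, 1] `*` `[0, 1] : set (R * R)) (fun p => W p.1 p.2),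
      forall x y, x \in `[0, 1] -> y \in `[0, 1] -> W x y = W y x
    & forall x y, x \in `[0, 1] -> y \in `[0, 1] -> 0 <= W x y <= 1].

(* Riemann integrability on [0,1]^2, in Darboux's form.  As in
   [itv_partition 0 1 s], the left endpoint 0 is not listed in s, so the cells
   of s are the intervals [division s i, division s i.+1], i < size s. *)

Definition division (R : realType) (s : seq R) (i : nat) : R :=
  nth 1 (0 :: s) i.

Definition cell_area (R : realType) (s t : seq R) (i j : nat) : R :=
  (division s i.+1 - division s i) * (division t j.+1 - division t j).

Definition cell_values (R : realType) (f : R -> R -> R) (s t : seq R)
    (i j : nat) : set R :=
  [set f x y | x in `[division s i, division s i.+1]
             & y in `[division t j, division t j.+1]].

Definition lower_sum (R : realType) (f : R -> R -> R) (s t : seq R) : R :=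
  \sum_(i < size s) \sum_(j < size t)
    cell_area s t i j * inf (cell_values f s t i j).

Definition upper_sum (R : realType) (f : R -> R -> R) (s t : seq R) : R :=
  \sum_(i < size s) \sum_(j < size t)
    cell_area s t i j * sup (cell_values f s t i j).

Definition lower_integral (R : realType) (f : R -> R -> R) : R :=
  sup [set lower_sum f s t | s in itv_partition 0 1 & t in itv_partition 0 1].

Definition upper_integral (R : realType) (f : R -> R -> R) : R :=
  inf [set upper_sum f s t | s in itv_partition 0 1 & t in itv_partition 0 1].

Definition riemann_integrable (R : realType) (f : R -> R -> R) : Prop :=
  (exists M, forall x y, x \in `[0, 1] -> y \in `[0, 1] -> `|f x y| <= M) /\
  lower_integral f = upper_integral f.

Definition phi (R : realType) (W : R -> R -> R) : \bar R :=
  ereal_sup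
    [set ((fine (lebesgue_measure S))^-1%:E *
           \int[lebesgue_measure]_(x in S)
             \int[lebesgue_measure]_(y in S) (ln (1 / (1 - W x y)))%:E)%E
    | S in [set S : set R | [/\ measurable S, S `<=` `[0, 1]
                              & (0 < lebesgue_measure S)%E]]].

(* Probability that the edge set is that of g when the vertex types are x and
   each pair i < j is joined independently with probability W x_i x_j. *)
Definition edges_prob (R : realType) (W : R -> R -> R) (n : nat)
    (x : n.-tuple R) (g : sgraph n) : R :=
  \prod_(p : 'I_n * 'I_n | (p.1 < p.2)%N)
    (if adj g p.1 p.2 then W (tnth x p.1) (tnth x p.2)
     else 1 - W (tnth x p.1) (tnth x p.2)).

Definition independent_RVs (d : measure_display) (T : measurableType d)
    (R : realType) (P : probability T R) (n : nat)
    (X : 'I_n -> {RV P >-> R}) : Prop :=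
  forall A : 'I_n -> set R, (forall i, measurable (A i)) ->
    P (\bigcap_(i in [set: 'I_n]) (X i @^-1` A i)) =
    (\prod_(i < n) P (X i @^-1` A i))%E.

Definition sample (d : measure_display) (T : measurableType d)
    (R : realType) (P : probability T R) (n : nat)
    (X : 'I_n -> {RV P >-> R}) (w : T) : n.-tuple R :=
  [tuple X i w | i < n].

(* G is distributed as G(n, W), with vertex types X.  The last clause says that
   P (G = g | X) = edges_prob W X g almost surely, i.e. that both sides have
   the same integral over every event of the sigma-algebra generated by X. *)
Record is_random_graph (d : measure_display) (T : measurableType d)
    (R : realType) (P : probability T R) (W : R -> R -> R) (n : nat)
    (X : 'I_n -> {RV P >-> R}) (G : T -> sgraph n) : Prop := {
  rg_unit : forall i w, X i w \in `[0, 1] ;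
  rg_uniform : forall i (A : set R), measurable A ->
    distribution P (X i) A = uniform_prob (@ltr01 R) A ;
  rg_independent : independent_RVs X ;
  rg_measurable : forall g, measurable (G @^-1` [set g]) ;
  rg_conditional : forall (g : sgraph n) (B : set (n.-tuple R)),
    measurable B ->
    P (sample X @^-1` B `&` G @^-1` [set g]) =
    (\int[P]_(w in sample X @^-1` B) (edges_prob W (sample X w) g)%:E)%E
}.

(* Main.v *)
(* Idea. Darboux sums give a partition of [0,1] into finitely many types such
   that W is dominated by a step function which is close to W in L^1; the
   quadratic form of its logarithmic costs c = ln (1/(1-W)) is then at most
   (phi W + o(1)) times the total mass on every subvector y of the vector P of
   type densities: small sets are controlled by the boundedness of c, large ones
   by the L^1 approximation.

   Condition on the types, and look for colour classes of size proportional to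
   2 ln n whose composition is proportional to P.  The bound on the quadratic form
   is exactly what makes the second moment of the number of such independent sets
   work, also inside n^(1-delta) prescribed vertices of each type.  To get
   exponentially small failure probability, let f be the largest size of a family
   of such independent sets no two of which share a pair of vertices: Turan's
   theorem and the second moment give E f >= n^(7/4-o(1)), while f is 1-Lipschitz in
   the at most n^2 edges, so Azuma's inequality yields
   P(f = 0) <= exp(-n^(3/2-o(1))).  This beats the union bound over all the places
   where one may look, so that colour classes can be extracted greedily until o(n / ln n)
   vertices remain, which receive private colours. *)

Require Import Defs.
From mathcomp Require Import all_boot all_order all_algebra.
From mathcomp Require Import all_classical all_reals all_analysis.
From mathcomp Require Import measurable_realfun ring lra.
Import Order.TTheory GRing.Theory Num.Theory.
Import numFieldNormedType.Exports.
Local Open Scope ring_scope.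
Set Implicit Arguments.
Unset Strict Implicit.
Unset Printing Implicit Defensive.

(** * Bernoulli product measures *)

(** A second moment alone makes the failure probability polynomially small, while greedy extraction
    looks in places that depend on the graph, so a union bound over up to exp(O(n (ln n)^2)) places
    is needed. If the packing number has mean m, Azuma over n^2 coordinates gives exp(-c m^2/n^2),
    so any m well above n^(3/2) suffices. Two shared vertices limit m to about n^2; the choice
    n^(7/4) leaves n^(1/4) for shrinking the parts to n^(1-d) vertices and for the bounded cost of a
    few coincidences.

    Riemann integrability reconciles two demands: the colour classes meet [W] pointwise, at every
    sampled type, whereas [phi] sees only integrals. A step function above [W] everywhere and close
    to it in L^1 answers both.

    Probability with fixed types is finite: expectations are iterated averages over Boolean
    configurations, and measure theory enters only to approximate [W], to sample the types and to
    disintegrate the law of the graph. *)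

Section Bernoulli.
Variables (R : realType) (I : finType) (w : I -> R).
Implicit Types (e : {ffun I -> bool}) (f g : {ffun I -> bool} -> R).

Definition update e i b : {ffun I -> bool} := [ffun j => if j == i then b else e j].

Definition average i f e :=
  w i * f (update e i true) + (1 - w i) * f (update e i false).

Definition averages (s : seq I) f := foldr average f s.

(** Expectation under independent Bernoulli variables with parameters [w i]. Every coordinate of
    [enum I] is averaged out, so the initial configuration is immaterial. The partial averages form
    the Doob martingale on which the concentration bound inducts. *)
Definition expect f := averages (enum I) f [ffun=> false].

Hypothesis w01 : forall i, 0 <= w i <= 1.

Let w_ge0 i : 0 <= w i. Proof. by case/andP: (w01 i). Qed.
Let w_le1 i : 0 <= 1 - w i. Proof. by rewrite subr_ge0; case/andP: (w01 i). Qed.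

Lemma averages_le s f g : (forall e, f e <= g e) ->
  forall e, averages s f e <= averages s g e.
Proof.
move=> fg; elim: s => //= i s IHs e.
by apply: lerD; apply: ler_wpM2l.
Qed.

Lemma averages_eq s f g : f =1 g -> averages s f =1 averages s g.
Proof. by move=> fg; elim: s => //= i s IHs e; rewrite /average !IHs. Qed.

Lemma averagesD s f g e :
  averages s (fun e => f e + g e) e = averages s f e + averages s g e.
Proof. by elim: s e => //= i s IHs e; rewrite /average !IHs; ring. Qed.

Lemma averagesZ s k f e :
  averages s (fun e => k * f e) e = k * averages s f e.
Proof. by elim: s e => //= i s IHs e; rewrite /average !IHs; ring. Qed.

Lemma averages_cst s k e : averages s (fun=> k) e = k.
Proof. by elim: s e => //= i s IHs e; rewrite /average !IHs; ring. Qed.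

Lemma averages_sum s (T : finType) (A : pred T) (F : T -> {ffun I -> bool} -> R) e :
  averages s (fun e => \sum_(x | A x) F x e) e = \sum_(x | A x) averages s (F x) e.
Proof.
elim: s e => //= i s IHs e; rewrite /average !IHs !mulr_sumr -big_split /=.
by [].
Qed.

Lemma averages_prod s (h : I -> bool -> R) e : uniq s ->
  averages s (fun e => \prod_i h i (e i)) e =
  \prod_i (if i \in s then w i * h i true + (1 - w i) * h i false else h i (e i)).
Proof.
elim: s e => [|i s IHs] e /=; first by move=> _; apply: eq_bigr.
case/andP=> is_ us; rewrite /average !IHs //.
pose Q := \prod_(j | j != i)
  (if j \in i :: s then w j * h j true + (1 - w j) * h j false else h j (e j)).
have E b : \prod_j (if j \in s then w j * h j true + (1 - w j) * h j false
    else h j (update e i b j)) = h i b * Q.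
  rewrite (bigD1 i) //= (negPf is_) ffunE eqxx; congr (_ * _).
  by apply: eq_bigr => j ji; rewrite ffunE (negPf ji) in_cons (negPf ji).
by rewrite !E [RHS](bigD1 i) //= in_cons eqxx /= -/Q; ring.
Qed.

Definition lipschitz1 f := forall e i b, `|f (update e i b) - f e| <= 1.

Lemma update_comm e i j b c : i != j ->
  update (update e i b) j c = update (update e j c) i b.
Proof.
move=> ij; apply/ffunP=> k; rewrite !ffunE.
by case: (eqVneq k j) => [->|//]; rewrite eq_sym (negPf ij).
Qed.

Lemma update_id e i b c : update (update e i b) i c = update e i c.
Proof. by apply/ffunP=> k; rewrite !ffunE; case: eqP. Qed.

Lemma lipschitz1_average i f : lipschitz1 f -> lipschitz1 (average i f).
Proof.
move=> lf e j b; rewrite /average.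
have [->|ij] := eqVneq j i; first by rewrite !update_id subrr normr0.
rewrite !(@update_comm e j i) // opprD addrACA -!mulrBr.
apply: le_trans (ler_normD _ _) _; rewrite !normrM (ger0_norm (w_ge0 i)) (ger0_norm (w_le1 i)).
rewrite [leRHS](_ : 1 = w i * 1 + (1 - w i) * 1); last by ring.
by apply: lerD; apply: ler_wpM2l.
Qed.

Lemma lipschitz1_averages s f : lipschitz1 f -> lipschitz1 (averages s f).
Proof. by elim: s => //= i s IHs /IHs; apply: lipschitz1_average. Qed.

(** The function [h y], that is (1 + y + y^2) exp(-y), has derivative y (1 - y) exp(-y), so on
    [-1, 1] it is least at 0, where it equals 1. *)
Lemma expR_le_quadratic (x : R) : `|x| <= 1 -> expR x <= 1 + x + x ^+ 2.
Proof.
move=> x1; have /andP[xl xu] : -1 <= x <= 1 by rewrite -ler_norml.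
pose h (y : R) := (1 + y + y ^+ 2) * expR (- y).
suff : 1 <= h x.
  by rewrite /h expRN ler_pdivlMr ?expR_gt0 // mul1r.
have dh (y : R) : is_derive y (1 : R) h (y * (1 - y) * expR (- y)).
  rewrite /h; apply: is_derive_eq.
  by rewrite /GRing.scale /=; ring.
have h0 : h 0 = 1 by rewrite /h oppr0 expR0 mulr1; ring.
have dd (y : R) : derivable h y (1 : R) by case: (dh y).
have [x0|x0] := leP 0 x.
  rewrite -h0; apply: (@ger0_derive1_le_cc _ h 0 x) => //.
  - move=> y; rewrite in_itv /= => /andP[y0 yx].
    rewrite derive1E (derive_val (is_derive := dh y)).
    by rewrite mulr_ge0 ?expR_ge0 // mulr_ge0 //; lra.
  - by apply: derivable_within_continuous => y _.
  - by rewrite in_itv /= lexx.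
  - by rewrite in_itv /= lexx x0.
rewrite -h0; apply: (@ler0_derive1_le_cc _ h x 0) => //.
- move=> y; rewrite in_itv /= => /andP[y0 yx].
  rewrite derive1E (derive_val (is_derive := dh y)).
  rewrite mulr_le0_ge0 ?expR_ge0 // mulr_le0_ge0 //; lra.
- by apply: derivable_within_continuous => y _.
- by rewrite in_itv /= lexx (ltW x0).
- by rewrite in_itv /= lexx (ltW x0).
- exact: ltW.
Qed.

(** One step of Azuma's inequality: the deviations [f1 - m] and [f0 - m] are at most 1 in absolute
    value and have mean zero, so the linear term of the quadratic bound cancels. *)
Lemma average_expR_le i f (l : R) : 0 <= l <= 1 -> lipschitz1 f ->
  forall e, average i (fun e => expR (- l * f e)) e <=
            expR (- l * average i f e + l ^+ 2).
Proof.
move=> /andP[l0 l1] lf e.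
pose f1 := f (update e i true); pose f0 := f (update e i false).
pose m := average i f e.
have f10 : `|f1 - f0| <= 1.
  by rewrite /f1 -(update_id e i false true); apply: lf.
have mE : m = w i * f1 + (1 - w i) * f0 by [].
have step (b : R) : `|b - m| <= 1 ->
    expR (- l * b) <= expR (- l * m) * (1 - l * (b - m) + l ^+ 2).
  move=> bm; have -> : - l * b = - l * m + - l * (b - m) by ring.
  rewrite expRD ler_pM2l ?expR_gt0 //.
  apply: le_trans (expR_le_quadratic _) _.
    by rewrite normrM normrN (ger0_norm l0) -[X in _ <= X](mulr1 1) ler_pM.
  rewrite exprMn sqrrN mulNr lerD2l.
  rewrite -[X in _ <= X]mulr1 ler_wpM2l ?sqr_ge0 //.
  by rewrite -real_normK ?num_real // -[X in _ <= X](expr1n _ 2) lerXn2r ?nnegrE.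
have b1 : `|f1 - m| <= 1.
  have -> : f1 - m = (1 - w i) * (f1 - f0) by rewrite mE; ring.
  rewrite normrM ger0_norm // -[X in _ <= X]mulr1 ler_pM //.
  by rewrite lerBlDr lerDl.
have b0 : `|f0 - m| <= 1.
  have -> : f0 - m = - (w i * (f1 - f0)) by rewrite mE; ring.
  rewrite normrN normrM ger0_norm // -[X in _ <= X]mulr1 ler_pM //.
  by case/andP: (w01 i).
rewrite expRD; apply: (@le_trans _ _ (expR (- l * m) * (1 + l ^+ 2))); last first.
  by rewrite ler_pM2l ?expR_gt0 // expR_ge1Dx.
rewrite {1}/average -/f1 -/f0.
apply: le_trans (lerD (ler_wpM2l (w_ge0 i) (step _ b1))
                      (ler_wpM2l (w_le1 i) (step _ b0))) _.
by rewrite le_eqVlt; apply/orP; left; apply/eqP; rewrite mE; ring.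
Qed.

Lemma averages_expR_le s f (l : R) : 0 <= l <= 1 -> lipschitz1 f ->
  forall e, averages s (fun e => expR (- l * f e)) e <=
            expR (- l * averages s f e + l ^+ 2 * (size s)%:R).
Proof.
move=> l01 lf; elim: s => [|i s IHs] e /=; first by rewrite mulr0 addr0.
have -> : l ^+ 2 * (size s).+1%:R = l ^+ 2 + l ^+ 2 * (size s)%:R :> R.
  by rewrite -natr1 mulrDr mulr1 addrC.
rewrite addrA expRD.
apply: (@le_trans _ _ (average i (fun e => expR (- l * averages s f e + l ^+ 2 * (size s)%:R)) e)).
  exact: (averages_le [:: i] IHs).
apply: le_trans (ler_wpM2r (expR_ge0 _)
  (average_expR_le i l01 (lipschitz1_averages s lf) e)).
by rewrite /average /= [leRHS]mulrDl -!(mulrA _ (expR _) (expR _)) -!expRD.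
Qed.

(** Markov's inequality for [expR (- l * f e)], which is at least 1 on [A]. The parameter [l] stays
    free: the packing number and the type counts need different values. *)
Lemma expect_lower_tail f (m l : R) (A : pred {ffun I -> bool}) :
  0 <= l <= 1 -> lipschitz1 f -> m <= expect f -> (forall e, A e -> f e <= 0) ->
  expect (fun e => (A e)%:R) <= expR (- l * m + l ^+ 2 * #|I|%:R).
Proof.
move=> l01 lf mf Af; have l0 : 0 <= l by case/andP: l01.
apply: (@le_trans _ _ (expect (fun e => expR (- l * f e)))).
  apply: averages_le => e; case: (boolP (A e)) => /= [/Af fe|_]; last exact: expR_ge0.
  by rewrite -[X in X <= _]expR0 ler_expR mulNr oppr_ge0 mulr_ge0_le0.
apply: le_trans (averages_expR_le _ l01 lf _) _.
by rewrite ler_expR -cardE lerD2r !mulNr lerN2 ler_wpM2l.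
Qed.

Lemma expect_le f g : (forall e, f e <= g e) -> expect f <= expect g.
Proof. by move=> fg; apply: averages_le. Qed.

Lemma expect_eq f g : f =1 g -> expect f = expect g.
Proof. by move=> fg; apply: averages_eq. Qed.

Lemma expect_prod (h : I -> bool -> R) :
  expect (fun e => \prod_i h i (e i)) =
  \prod_i (w i * h i true + (1 - w i) * h i false).
Proof.
rewrite /expect averages_prod ?enum_uniq //.
by apply: eq_bigr => i _; rewrite mem_enum.
Qed.

Lemma expect_absent (S : {set I}) :
  expect (fun e => [forall i in S, ~~ e i]%:R) = \prod_(i in S) (1 - w i).
Proof.
rewrite (expect_eq (g := fun e => \prod_i (~~ (e i && (i \in S)))%:R)); last first.
  move=> e; case: (boolP [forall i in S, ~~ e i]) => [/forall_inP H|].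
    by rewrite big1 // => i _; case: (boolP (i \in S)) => [/H/negPf->|]; rewrite ?andbF.
  rewrite negb_forall_in => /exists_inP[i iS /negPn ei].
  by rewrite (bigD1 i) //= ei iS /= mul0r.
rewrite (expect_prod (fun i b => (~~ (b && (i \in S)))%:R)) [RHS]big_mkcond.
apply: eq_bigr => i _ /=; case: (i \in S) => /=; first by rewrite mulr0 add0r mulr1.
by ring.
Qed.

End Bernoulli.

(** * Packings of independent sets *)

Section FiniteSets.
Import boot.fintype boot.finset.

(** It suffices that 2SN <= Z' + bN^2, an instance of the inequality of arithmetic and geometric
    means: (2SN)^2 <= 4bZ'N^2 <= (Z' + bN^2)^2. *)
Lemma turan_step (R : realFieldType) (S N Z Z' b : R) :
  0 <= S -> 0 <= N -> 0 <= Z' -> 0 <= b -> S ^+ 2 <= b * Z' -> Z' + N ^+ 2 <= Z ->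
  (S + N) ^+ 2 <= (b + 1) * Z.
Proof.
move=> S0 N0 Z0 b0 SZ ZZ.
suff H : 2 * (S * N) <= Z' + b * N ^+ 2.
  apply: (@le_trans _ _ ((b + 1) * (Z' + N ^+ 2))); last by rewrite ler_wpM2l // addr_ge0.
  by nra.
rewrite -(@ler_sqr _ (2 * (S * N))) ?nnegrE; last 2 first.
- by rewrite mulr_ge0 // mulr_ge0.
- by rewrite addr_ge0 // mulr_ge0 // sqr_ge0.
have := ler_wpM2r (sqr_ge0 N) SZ.
have := sqr_ge0 (Z' - b * N ^+ 2).
by nra.
Qed.

(* Motzkin-Straus form of Turan's theorem, by the greedy argument: select the
   vertex whose closed neighbourhood has least weight, then delete that
   neighbourhood. *)
Lemma weighted_turan (R : realFieldType) (T : finType) (r : rel T) (u : T -> R)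
    (A : {set T}) : reflexive r -> symmetric r -> (forall x, 0 <= u x) ->
  exists B : {set T}, [/\ B \subset A, {in B &, forall x y, r x y -> x = y}
    & (\sum_(x in A) u x) ^+ 2 <=
      #|B|%:R * \sum_(x in A) \sum_(y in A | r x y) u x * u y].
Proof.
move=> rr rs u0; have [m] := ubnP #|A|; elim: m A => // m IHm A Am.
have [->|[x0 x0A]] := set_0Vmem A.
  exists set0; split=> //; first by move=> x y; rewrite inE.
  by rewrite !big_set0 mulr0 expr0n.
pose N x := \sum_(y in A | r x y) u y.
have [v vA vmin] : exists2 v, v \in A & forall x, x \in A -> N v <= N x.
  by case: (@arg_minP _ _ _ x0 (mem A) N x0A) => v; exists v.
pose C := [set y in A | r v y].
have [|B' [B'A B'r B'le]] := IHm (A :\: C).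
  rewrite -ltnS; apply: leq_trans _ Am; rewrite ltnS; apply: proper_card.
  apply/properP; split; first exact: subsetDl.
  by exists v => //; rewrite !inE vA rr.
have vB' : v \notin B'.
  by apply/negP => /(subsetP B'A); rewrite !inE vA rr.
exists (v |: B'); split.
- rewrite subUset sub1set vA (subset_trans B'A) //; exact: subsetDl.
- have H y : y \in B' -> ~~ r v y.
    by move=> /(subsetP B'A); rewrite !inE => /andP[+ yA]; rewrite yA.
  move=> x y /setU1P[->|xB] /setU1P[->|yB] //.
  + by rewrite (negPf (H _ yB)).
  + by rewrite rs (negPf (H _ xB)).
  + exact: B'r.
have split_sum (G : T -> R) :
    \sum_(x in A) G x = \sum_(x in A :\: C) G x + \sum_(x in C) G x.
  rewrite (big_setID C) /= addrC; congr (_ + _); apply: eq_bigl => x.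
  by rewrite !inE; case: (x \in A).
have NE : N v = \sum_(x in C) u x by apply: eq_bigl => x; rewrite inE.
have N0 x : 0 <= N x by apply: sumr_ge0.
rewrite cardsU1 vB' /= addnC natrD (split_sum u) -NE.
apply: turan_step B'le _ => //; [exact: sumr_ge0| |].
  by apply: sumr_ge0 => x _; apply: sumr_ge0 => y _; apply: mulr_ge0.
rewrite (split_sum (fun x => _)) lerD //.
- apply: ler_sum => x _; rewrite big_mkcondr [leRHS]big_mkcondr.
  rewrite [leRHS](bigID (mem (A :\: C))) /= -[leLHS]addr0 lerD //.
    rewrite le_eqVlt; apply/orP; left; apply/eqP; apply: eq_bigl => y.
    by rewrite !inE; case: (y \in A); rewrite ?andbF.
  by apply: sumr_ge0 => y _; case: ifP => // _; apply: mulr_ge0.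
- rewrite expr2 {1}NE mulr_suml; apply: ler_sum => x.
  rewrite inE => /andP[xA _]; rewrite -mulr_sumr.
  by rewrite ler_wpM2l // vmin.
Qed.

Section Packing.
Variables (R : realType) (I F : finType) (w : I -> R) (ed : F -> {set I}).
Hypothesis w01 : forall i, 0 <= w i < 1.
Implicit Types (e : {ffun I -> bool}).

Let w01' i : 0 <= w i <= 1. Proof. by case/andP: (w01 i) => -> /ltW. Qed.

Definition absent e (f : F) := [forall i in ed f, ~~ e i].

(** The diagonal is added by hand because [ed f] may be empty, whereas Turan's theorem is applied to
    a reflexive relation. *)
Definition conflict (f g : F) := (f == g) || (ed f :&: ed g != set0).

Definition packing e (B : {set F}) :=
  [forall f in B, absent e f] &&
  [forall f in B, forall g in B, conflict f g ==> (f == g)].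

Definition packing_number e : nat := \max_(B | packing e B) #|B|.

Let Q (S : {set I}) := \prod_(i in S) (1 - w i).

Lemma leq_packing_number e B : packing e B -> (#|B| <= packing_number e)%N.
Proof.
by move=> pB; rewrite /packing_number; apply: (leq_bigmax_cond (F := fun B : {set F} => #|B|)).
Qed.

Lemma packing_number_attained e : exists2 B, packing e B & packing_number e = #|B|.
Proof.
have p0 : packing e set0.
  by apply/andP; split; apply/forall_inP => f; rewrite inE.
have := @eq_bigmax_cond _ (packing e) (fun B : {set F} => #|B|).
by case=> [|B pB ?]; [apply/card_gt0P; exists set0 | exists B].
Qed.

(** At most one member of a packing contains the coordinate [i]; discarding it leaves a packing for
    the changed configuration. *)
Lemma packing_number_update e i b :
  (packing_number e <= (packing_number (update e i b)).+1)%N.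
Proof.
have [B /andP[/forall_inP Ba /forall_inP Bc] ->] := packing_number_attained e.
pose C := [set f in B | i \in ed f].
have C1 : (#|C| <= 1)%N.
  apply/card_le1_eqP => f g; rewrite !inE => /andP[fB fi] /andP[gB gi].
  move/forall_inP: (Bc _ fB) => /(_ _ gB) /implyP H; apply/eqP; rewrite eq_sym; apply: H.
  by apply/orP; right; apply/set0Pn; exists i; rewrite inE fi.
rewrite -(cardsID C B) -addn1 addnC leq_add //; last first.
  by rewrite (leq_trans (subset_leq_card (subsetIr B C))).
apply: leq_packing_number; apply/andP; split.
  apply/forall_inP => f /setDP[fB]; rewrite inE fB /= => fi.
  apply/forall_inP => j jf; rewrite ffunE.
  case: eqP => [ji|_]; first by rewrite -ji jf in fi.
  by move/forall_inP: (Ba _ fB); apply.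
apply/forall_inP => f /setDP[fB _]; apply/forall_inP => g /setDP[gB _].
by move/forall_inP: (Bc _ fB) => /(_ _ gB).
Qed.

Lemma lipschitz1_packing_number :
  lipschitz1 (fun e => (packing_number e)%:R : R).
Proof.
move=> e i b.
have H1 := packing_number_update e i b.
have := packing_number_update (update e i b) i (e i).
have -> : update (update e i b) i (e i) = e.
  by apply/ffunP => j; rewrite !ffunE; case: eqP => // ->.
move=> H2; move: H1 H2; rewrite -!(ler_nat R) -!natr1 ler_norml => H1 H2.
by apply/andP; split; lra.
Qed.

Lemma prod_setUI (A B : {set I}) : Q (A :|: B) * Q (A :&: B) = Q A * Q B.
Proof.
rewrite /Q (big_setID A) /= setUK setDUl setDv set0U.
rewrite [X in _ = _ * X](big_setID A) /= [B :&: A]setIC.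
by rewrite -mulrA [X in _ * X]mulrC.
Qed.

Let Q_gt0 S : 0 < Q S.
Proof. by apply: prodr_gt0 => i _; rewrite subr_gt0; case/andP: (w01 i). Qed.

(** Each [f] is weighted by the inverse of its probability of being absent, so that [S] has mean
    [#|F|] and, by [prod_setUI], a conflicting pair contributes to the mean of [Z] the inverse
    probability of its intersection. Turan's bound S^2/Z is not linear; it is replaced by its
    tangent 2tS - t^2 Z, whose mean is available, and t = |F|/Z0 is the optimal slope. *)
Lemma expect_packing_number (Z0 : R) : 0 < Z0 ->
  \sum_f \sum_(g | conflict f g) (Q (ed f :&: ed g))^-1 <= Z0 ->
  #|F|%:R ^+ 2 / Z0 <= expect w (fun e => (packing_number e)%:R).
Proof.
move=> Z00 Zle.
pose u f := (Q (ed f))^-1.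
have u0 f : 0 <= u f by rewrite invr_ge0 ltW.
pose S e := \sum_f u f * (absent e f)%:R.
pose Z e := \sum_f \sum_(g | conflict f g) (u f * u g) * (absent e f && absent e g)%:R.
have cr : reflexive conflict by move=> f; rewrite /conflict eqxx.
have cs : symmetric conflict by move=> f g; rewrite /conflict eq_sym setIC.
pose t := #|F|%:R / Z0.
have pk e : 2 * t * S e + - t ^+ 2 * Z e <= (packing_number e)%:R.
  have [B [BA Br]] := weighted_turan [set f | absent e f] cr cs u0.
  have -> : \sum_(x in [set f | absent e f]) u x = S e.
    rewrite big_mkcond; apply: eq_bigr => f _; rewrite inE.
    by case: (absent e f); rewrite ?mulr1 ?mulr0.
  have -> : \sum_(x in [set f | absent e f])
      \sum_(y in [set f | absent e f] | conflict x y) u x * u y = Z e.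
    rewrite big_mkcond; apply: eq_bigr => f _; rewrite inE.
    case: (absent e f) => /=; last by rewrite big1 // => g _; rewrite mulr0.
    rewrite big_mkcondl; apply: eq_bigr => g _; rewrite inE.
    by case: (absent e g); rewrite ?mulr1 ?mulr0.
  have pB : packing e B.
    apply/andP; split.
      by apply/forall_inP => f /(subsetP BA); rewrite inE.
    by apply/forall_inP => f fB; apply/forall_inP => g gB; apply/implyP => /Br ->.
  have := leq_packing_number pB; rewrite -(ler_nat R) => Bp SZ.
  apply: le_trans Bp.
  have Z_ge0 : 0 <= Z e.
    by apply: sumr_ge0 => f _; apply: sumr_ge0 => g _; rewrite !mulr_ge0.
  have B0 : 0 <= #|B|%:R :> R by [].
  move: SZ Z_ge0 B0; set X := S e; set Y := Z e; set b := #|B|%:R => SZ Y0 b0.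
  (* If [Z] vanishes then so does [S]; otherwise multiply by [Z] and complete the square. *)
  have [Y_eq0|Y_neq0] := eqVneq Y 0.
    have : X ^+ 2 <= 0 by rewrite (le_trans SZ) // Y_eq0 mulr0.
    move=> X2; have /eqP : X ^+ 2 = 0 by apply/eqP; rewrite eq_le X2 sqr_ge0.
    by rewrite sqrf_eq0 => /eqP ->; rewrite Y_eq0 !mulr0 addr0.
  have Y_gt0 : 0 < Y by rewrite lt_neqAle eq_sym Y_neq0.
  rewrite -(ler_pM2r Y_gt0); apply: le_trans SZ.
  by have := sqr_ge0 (X - t * Y); nra.
apply: le_trans (expect_le w01' pk).
rewrite /expect averagesD !averagesZ -!/(expect _ _).
have -> : expect w S = #|F|%:R.
  rewrite /expect /S averages_sum -sum1_card natr_sum; apply: eq_bigr => f _.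
  rewrite averagesZ -/(expect w _) expect_absent /u mulVf //.
  by rewrite gt_eqF // Q_gt0.
have : expect w Z <= Z0.
  apply: le_trans Zle; rewrite le_eqVlt; apply/orP; left; apply/eqP.
  rewrite /expect /Z averages_sum; apply: eq_bigr => f _.
  rewrite averages_sum; apply: eq_bigr => g _; rewrite averagesZ -/(expect w _).
  rewrite (@expect_eq _ _ _ _ (fun e => [forall i in ed f :|: ed g, ~~ e i]%:R)); last first.
    move=> e; congr (_%:R); congr nat_of_bool; apply/andP/forall_inP.
      by move=> [/forall_inP Hf /forall_inP Hg] i /setUP[/Hf|/Hg].
    move=> H; split; apply/forall_inP => i ie; apply: H; rewrite inE ie ?orbT //.
  rewrite expect_absent -/(Q _) /u -invfM -prod_setUI invfM.
  by rewrite mulrAC mulVf ?mul1r // gt_eqF // Q_gt0.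
move=> Zle0; rewrite mulNr.
apply: (@le_trans _ _ (2 * t * #|F|%:R - t ^+ 2 * Z0)); last first.
  by rewrite lerD2l lerN2 ler_wpM2l // sqr_ge0.
rewrite le_eqVlt; apply/orP; left; apply/eqP; rewrite /t; field.
by rewrite gt_eqF.
Qed.

(** When no [f] is absent the only packing is empty, so the lower tail applies to the event that the
    packing number is 0. *)
Lemma expect_none_absent (Z0 m l : R) : 0 < Z0 -> 0 <= l <= 1 ->
  \sum_f \sum_(g | conflict f g) (Q (ed f :&: ed g))^-1 <= Z0 ->
  m * Z0 <= #|F|%:R ^+ 2 ->
  expect w (fun e => [forall f, ~~ absent e f]%:R) <=
    expR (- l * m + l ^+ 2 * #|I|%:R).
Proof.
move=> Z00 l01 Zle mZ.
apply: (expect_lower_tail w01' l01 lipschitz1_packing_number).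
  by rewrite -(ler_pdivlMr _ _ Z00) in mZ; apply: le_trans mZ (expect_packing_number Z00 Zle).
move=> e /forallP H; have [B /andP[/forall_inP Ba _] ->] := packing_number_attained e.
have [->|[f fB]] := set_0Vmem B; first by rewrite cards0.
by have := Ba _ fB; rewrite (negPf (H f)).
Qed.

End Packing.

End FiniteSets.

(** * Second moment for transversals of disjoint parts *)

Section Transversal.
Import boot.fintype boot.finset.
Variables (R : realType) (n : nat) (J : finType) (r : nat) (v : J -> 'I_r -> 'I_n).
Implicit Types (f g : {ffun J -> 'I_r}) (X : {set 'I_n}).

Definition pairs X : {set 'I_n * 'I_n} :=
  [set p : 'I_n * 'I_n | [&& (p.1 < p.2)%N, p.1 \in X & p.2 \in X]].

Definition transversal_of f : {set 'I_n} := [set v j (f j) | j in J].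

Hypothesis v_inj : forall j k a b, v j a = v k b -> j = k /\ a = b.

Lemma card_transversal_of f : #|transversal_of f| = #|J|.
Proof. by rewrite card_imset // => j k /v_inj[]. Qed.

Lemma transversal_ofI f g :
  transversal_of f :&: transversal_of g = [set v j (f j) | j in [set j | f j == g j]].
Proof.
apply/setP => x; apply/setIP/imsetP.
  move=> [/imsetP[j _ ->] /imsetP[k _ /v_inj[jk fg]]]; exists j => //.
  by rewrite inE fg jk.
move=> [j]; rewrite inE => /eqP fg ->; split; first exact: imset_f.
by rewrite fg; apply: imset_f.
Qed.

Lemma pairsI X Y : pairs X :&: pairs Y = pairs (X :&: Y).
Proof.
apply/setP => p; rewrite !inE.
by case: (_ < _)%N; case: (p.1 \in X); case: (p.2 \in X); case: (p.1 \in Y).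
Qed.

Lemma conflict_transversal f g : (1 < #|J|)%N ->
  conflict (pairs \o transversal_of) f g ->
  (1 < #|transversal_of f :&: transversal_of g|)%N.
Proof.
move=> J2; case/orP => [/eqP ->|]; first by rewrite setIid card_transversal_of.
case/set0Pn => p; rewrite /= pairsI inE => /and3P[lt_p p1 p2].
by apply/card_gt1P; exists p.1, p.2; split=> //; rewrite neq_ltn lt_p.
Qed.

(** This factorisation over the parts is the reason for choosing exactly one vertex in each part. *)
Lemma sum_sum_prod_ffun (h : 'I_r -> 'I_r -> R) :
  \sum_(f : {ffun J -> 'I_r}) \sum_(g : {ffun J -> 'I_r}) \prod_j h (f j) (g j) =
  (\sum_a \sum_b h a b) ^+ #|J|.
Proof.
rewrite (eq_bigr (fun f : {ffun J -> 'I_r} => \prod_j \sum_b h (f j) b)); last first.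
  by move=> f _; rewrite bigA_distr_bigA.
by rewrite -(bigA_distr_bigA (fun _ a => \sum_b h a b)) prodr_const.
Qed.

Variables (w : 'I_n * 'I_n -> R) (c : 'I_n -> 'I_n -> R) (s : nat) (B l : R).
Hypothesis w01 : forall p, 0 <= w p < 1.
Hypothesis w_le : forall p : 'I_n * 'I_n, (p.1 < p.2)%N -> expR (- c p.1 p.2) <= 1 - w p.
Hypothesis J_gt1 : (1 < #|J|)%N.
Hypothesis J_le : (#|J| <= s)%N.
Hypothesis r_gt0 : (0 < r)%N.
Hypothesis B_gt0 : 0 < B.
Hypothesis l01 : 0 <= l <= 1.
Hypothesis overlap : forall f X, X \subset transversal_of f -> (1 < #|X|)%N ->
  expR (\sum_(p in pairs X) c p.1 p.2) <= B^-1 * (r%:R / s%:R) ^+ #|X|.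

(** Conflicting transversals share a set X of at least two vertices, whose cost is at most B^-1
    (r/s)^|X| by [overlap]. Summed over all pairs f, g, this product factorises, each part giving at
    most r^2 (1 + 1/s). As there are at most s parts, the corrections multiply to at most e; this is
    what the denominator s in [overlap] is for. *)
Lemma sum_conflict_le :
  \sum_f \sum_(g | conflict (pairs \o transversal_of) f g)
    (\prod_(i in pairs (transversal_of f) :&: pairs (transversal_of g)) (1 - w i))^-1
  <= B^-1 * expR 1 * #|{ffun J -> 'I_r}|%:R ^+ 2.
Proof.
set rho : R := r%:R / s%:R.
have s_gt0 : (0 < s)%N by apply: leq_trans J_le; apply: ltnW.
have rho_ge0 : 0 <= rho by rewrite divr_ge0.
pose h (a b : 'I_r) := if a == b then rho else 1.
apply: (@le_trans _ _ (\sum_(f : {ffun J -> 'I_r}) \sum_(g : {ffun J -> 'I_r}) B^-1 * \prod_j h (f j) (g j))).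
  apply: ler_sum => f _; rewrite [leRHS](bigID (conflict (pairs \o transversal_of) f)) /=.
  rewrite -[leLHS]addr0 lerD //; last first.
    apply: sumr_ge0 => g _; rewrite mulr_ge0 ?invr_ge0 ?(ltW B_gt0) //.
    by apply: prodr_ge0 => j _; rewrite /h; case: eqP.
  apply: ler_sum => g fg; rewrite pairsI.
  have X2 := conflict_transversal J_gt1 fg.
  have -> : \prod_j h (f j) (g j) = rho ^+ #|transversal_of f :&: transversal_of g|.
    rewrite transversal_ofI card_imset; last by move=> j k /v_inj[].
    rewrite -prodr_const [RHS]big_mkcond; apply: eq_bigr => j _.
    by rewrite inE.
  apply: le_trans (overlap (subsetIl _ _) X2).
  set X := _ :&: _; rewrite -[leRHS]invrK -expRN lef_pV2 ?posrE ?expR_gt0 //; last first.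
    by apply: prodr_gt0 => p _; rewrite subr_gt0; case/andP: (w01 p).
  rewrite -sumrN expR_sum; apply: ler_prod => p.
  by rewrite inE => /and3P[lt_p _ _]; rewrite expR_ge0 w_le.
under eq_bigr do rewrite -mulr_sumr.
rewrite -mulr_sumr sum_sum_prod_ffun -mulrA ler_pM2l ?invr_gt0 //.
have h_ge0 a b : 0 <= h a b by rewrite /h; case: ifP.
have hs : \sum_a \sum_b h a b <= r%:R ^+ 2 * expR s%:R^-1.
  apply: (@le_trans _ _ (\sum_(a < r) (r%:R + rho))).
    apply: ler_sum => a _; apply: (@le_trans _ _ (\sum_(b < r) (1 + (b == a)%:R * rho))).
      apply: ler_sum => b _; rewrite /h eq_sym; case: eqP => _.
        by rewrite mul1r lerDr.
      by rewrite mul0r addr0.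
    rewrite big_split /= sumr_const card_ord lerD2l.
    rewrite (bigD1 a) //= eqxx mul1r big1 ?addr0 // => b /negPf ->.
    by rewrite mul0r.
  have step : r%:R + rho <= r%:R * expR s%:R^-1.
    apply: le_trans (ler_wpM2l _ (expR_ge1Dx _)) => //.
    by rewrite mulrDr mulr1.
  by rewrite sumr_const card_ord -[leLHS]mulr_natl expr2 -[leRHS]mulrA ler_wpM2l.
apply: (@le_trans _ _ ((r%:R ^+ 2 * expR s%:R^-1) ^+ #|J|)).
  rewrite lerXn2r ?nnegrE // ?mulr_ge0 ?expR_ge0 ?exprn_ge0 //.
  by apply: sumr_ge0 => a _; apply: sumr_ge0.
rewrite exprMn -expRM_natl mulrC card_ffun card_ord natrX -!exprM mulnC.
rewrite ler_wpM2r ?exprn_ge0 // ler_expR ler_pdivrMr ?ltr0n //.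
by rewrite mul1r ler_nat.
Qed.

Lemma expect_no_transversal :
  expect w (fun e => [forall f, ~~ absent (pairs \o transversal_of) e f]%:R) <=
    expR (- l * (B * expR (-1)) + l ^+ 2 * #|{: 'I_n * 'I_n}|%:R).
Proof.
have F_gt0 : 0 < #|{ffun J -> 'I_r}|%:R :> R.
  by rewrite ltr0n card_ffun card_ord expn_gt0 r_gt0.
apply: (expect_none_absent w01 _ l01 sum_conflict_le).
  by rewrite mulr_gt0 ?exprn_gt0 // mulr_gt0 ?invr_gt0 ?expR_gt0.
rewrite mulrA [X in X * _](_ : _ = 1) ?mul1r // expRN.
by field; rewrite !gt_eqF ?expR_gt0.
Qed.

End Transversal.

(** * Greedy colouring *)

Section Greedy.
Import boot.fintype boot.finset.
Variables (n : nat) (K : finType) (tau : 'I_n -> K) (a : K -> nat) (r : nat).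
Implicit Types (U : {set 'I_n}) (k : K) (B : {set K}).

(* One part for each of the [a k] vertices of type [k] in a colour class; types
   outside [B], of which too few vertices remain, contribute none. *)
Definition parts B : finType := {k : K & 'I_((k \in B) * a k)}.

Definition respects_types B (v : parts B -> 'I_r -> 'I_n) :=
  (forall j i x y, v j x = v i y -> j = i /\ x = y) /\
  (forall j x, tau (v j x) = tag j).

Definition of_type k U := [set x in U | tau x == k].

Lemma card_parts B : (#|parts B| <= \sum_k a k)%N.
Proof.
rewrite card_tagged sumnE big_map big_enum /= leq_sum // => k _.
by rewrite card_ord; case: (k \in B); rewrite ?mul1n ?mul0n.
Qed.

Lemma card_of_type U : #|U| = (\sum_k #|of_type k U|)%N.
Proof.
rewrite -sum1_card (partition_big tau xpredT) //=; apply: eq_bigr => k _.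
by rewrite -sum1_card; apply: eq_bigl => x; rewrite !inE.
Qed.

Lemma exists_parts U B : (forall k, k \in B -> (a k * r <= #|of_type k U|)%N) ->
  B != set0 -> (0 < r)%N -> (forall k, 0 < a k)%N ->
  exists2 v : parts B -> 'I_r -> 'I_n, respects_types v & forall j x, v j x \in U.
Proof.
move=> Bbig /set0Pn[k0 k0B] r_gt0 a_gt0.
have [x0 _] : exists x0 : 'I_n, x0 \in of_type k0 U.
  by apply/card_gt0P; apply: leq_trans (Bbig _ k0B); rewrite muln_gt0 a_gt0.
(* Consecutive blocks of length [r] in the enumeration of each type; quotient and remainder by [r]
   recover the block and the position. *)
pose ix (j : parts B) (x : 'I_r) := (tagged j * r + x)%N.
have ix_lt j x : (ix j x < size (enum (of_type (tag j) U)))%N.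
  case: j => k [t /= tlt]; rewrite -cardE.
  have kB : k \in B by have := tlt; case: (k \in B).
  apply: leq_trans (Bbig _ kB); have tlt' := tlt; rewrite kB mul1n in tlt'.
  rewrite /ix /=; apply: (@leq_trans (t * r + r)%N); first by rewrite ltn_add2l.
  by rewrite -mulSnr leq_mul2r tlt' orbT.
pose v (j : parts B) x := nth x0 (enum (of_type (tag j) U)) (ix j x).
have vP j x : v j x \in of_type (tag j) U by rewrite -mem_enum mem_nth.
exists v; last by move=> j x; have := vP j x; rewrite inE => /andP[].
split; last by move=> j x; have := vP j x; rewrite inE => /andP[_ /eqP].
move=> j i x y vv.
have tji : tag j = tag i.
  have := vP j x; have := vP i y; rewrite vv !inE => /andP[_ /eqP ->].
  by move=> /andP[_ /eqP].
case: j i tji vv => [k t] [k' t'] /= kk'; subst k' => vv.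
pose p (t : 'I_((k \in B) * a k)) : parts B := existT _ k t.
have : ix (p t) x = ix (p t') y.
  apply/eqP; rewrite -(nth_uniq x0 (ix_lt (p t) x) (ix_lt (p t') y)) ?enum_uniq //.
  exact/eqP.
rewrite /ix /= => E.
have tt' : t = t'.
  by apply: val_inj; have := congr1 (divn^~ r) E; rewrite /= !divnMDl // !divn_small ?addn0.
split; first by rewrite tt'.
by apply: val_inj; have := congr1 (modn^~ r) E; rewrite /= !modnMDl !modn_small.
Qed.

Variable G : sgraph n.
Hypothesis a_gt0 : forall k, (0 < a k)%N.
Hypothesis r_gt0 : (0 < r)%N.
Hypothesis independent_transversal : forall B (v : parts B -> 'I_r -> 'I_n),
  B != set0 -> respects_types v ->
  exists f : {ffun parts B -> 'I_r}, forall x y,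
    x \in transversal_of v f -> y \in transversal_of v f -> ~~ adj G x y.

Let s := (\sum_k a k)%N.

Definition coloring U (m : nat) (col : 'I_n -> nat) :=
  (forall x, x \in U -> col x < m)%N /\
  (forall x y, x \in U -> y \in U -> adj G x y -> col x != col y).

Lemma trivial_coloring U m : (#|U| <= m)%N -> exists col, coloring U m col.
Proof.
move=> Um; exists (fun x => index x (enum U)); split=> [x xU|x y xU yU xy].
  by apply: leq_trans Um; rewrite cardE index_mem mem_enum.
apply/negP => /eqP /(@index_inj _ x _ _) -/(_ _ _) xyE.
have {}xyE : x = y by apply: xyE; rewrite ?mem_enum.
move: xy; rewrite xyE /adj; case: G => E /= /andP[/forallP/(_ y)].
by move=> /negPf ->.
Qed.

(** The hypothesis is the invariant: a new class removes at least [a k] vertices from every type in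
    [B], that is, from the types with at least [a k * r] vertices left; the other types already
    satisfy the bound for [T = 0]. Once [B] is empty, at most [s * r] vertices remain and are
    coloured separately. *)
Lemma greedy_coloring T U : (forall k, #|of_type k U| < T * a k + a k * r)%N ->
  exists col, coloring U (T + s * r) col.
Proof.
elim: T U => [|T IHT] U Usmall.
  apply: trivial_coloring; rewrite add0n card_of_type /s big_distrl /= leq_sum // => k _.
  by have := Usmall k; rewrite mul0n add0n => /ltnW.
pose B := [set k | a k * r <= #|of_type k U|]%N.
have [B0|B0] := eqVneq B set0.
  apply: trivial_coloring; apply: leq_trans (leq_addl _ _).
  rewrite card_of_type /s big_distrl /= leq_sum // => k _.
  by have := in_set0 k; rewrite -B0 inE => /negbT; rewrite -ltnNge => /ltnW.
have [k|v vtau vU] := @exists_parts U B _ B0 r_gt0 a_gt0; first by rewrite inE.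
have [f ind] := independent_transversal B0 vtau.
case: vtau => vinj vtype; pose X := transversal_of v f.
have XU : X \subset U by apply/subsetP => x /imsetP[j _ ->].
have [|col [colT colG]] := IHT (U :\: X).
  move=> k; have Uk := Usmall k.
  have [kB|kB] := boolP (k \in B); last first.
    apply: leq_trans (leq_addl _ _).
    move: kB; rewrite inE -ltnNge; apply: leq_ltn_trans; apply: subset_leq_card.
    by apply/subsetP => x; rewrite !inE => /andP[/andP[_ ->] ->].
  have Xk : (a k <= #|of_type k X|)%N.
    have card_k : (#|'I_((k \in B) * a k)| = a k)%N by rewrite card_ord kB mul1n.
    rewrite -[leqLHS]card_k -cardsT.
    pose p (t : 'I_((k \in B) * a k)) : parts B := existT _ k t.
    rewrite -(card_imset (f := fun t => v (p t) (f (p t))) setT).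
      apply: subset_leq_card; apply/subsetP => x /imsetP[t _ ->].
      by rewrite inE vtype eqxx andbT imset_f.
    move=> t t' /vinj[/(congr1 (fun j : parts B => val (tagged j))) tt' _].
    exact: val_inj.
  have : (#|of_type k (U :\: X)| + #|of_type k X| = #|of_type k U|)%N.
    rewrite addnC -(cardsID X (of_type k U)); congr (_ + _)%N; apply: eq_card => x;
    rewrite !inE.
      by case: (boolP (x \in X)) => [/(subsetP XU) ->|_]; rewrite ?andbT ?andbF.
    by rewrite andbA.
  move=> E; rewrite -(ltn_add2r #|of_type k X|) E; apply: leq_trans Uk _.
  by rewrite mulSnr addnAC leq_add2l.
(* The class just found takes the last colour, above all those of the recursive call. *)
exists (fun x => if x \in X then (T + s * r)%N else col x); split.
  move=> x xU; case: ifP => [_|/negbT xX]; first by rewrite addSn.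
  by rewrite addSn ltnS ltnW // colT // inE xX.
move=> x y xU yU xy; case: ifP => xX; case: ifP => yX.
- by rewrite (negPf (ind _ _ xX yX)) in xy.
- by rewrite gtn_eqF // colT // inE yX.
- by rewrite ltn_eqF // colT // inE xX.
- by apply: colG => //; rewrite inE ?xX ?yX.
Qed.

Lemma chromatic_number_le T :
  (forall k, #|of_type k [set: 'I_n]| < T * a k + a k * r)%N ->
  (chromatic_number G <= T + s * r)%N.
Proof.
move=> /greedy_coloring[col [colT colG]]; rewrite /chromatic_number.
case: ex_minnP => m _; apply.
have col_lt x : (col x < T + s * r)%N by apply: colT; rewrite inE.
apply/existsP; exists [ffun x => Ordinal (col_lt x)].
apply/forallP => x; apply/forallP => y; apply/implyP => xy; rewrite !ffunE.
by apply: contra_neq (colG x y (in_setT x) (in_setT y) xy) => /(congr1 val).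
Qed.

End Greedy.

(** * The random graph with prescribed types *)

Section BlockModel.
Import boot.fintype boot.finset.
Variables (R : realType) (n : nat).
Implicit Types (e : {ffun 'I_n * 'I_n -> bool}) (g : sgraph n).

(** The Bernoulli family is indexed by all ordered pairs; reading only the entry with increasing
    coordinates gives each edge a single coin. *)
Definition arcs_of e : {set 'I_n * 'I_n} :=
  [set p : 'I_n * 'I_n | (p.1 < p.2)%N && e p || (p.2 < p.1)%N && e (p.2, p.1)].

Lemma arcs_of_sgraph e : is_sgraph (arcs_of e).
Proof.
apply/andP; split; first by apply/forallP => i; rewrite inE /= ltnn.
by apply/forallP => i; apply/forallP => j; rewrite !inE /= orbC.
Qed.

Definition graph_of e : sgraph n := exist _ (arcs_of e) (arcs_of_sgraph e).

Lemma adj_graph_of e i j :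
  adj (graph_of e) i j = (i < j)%N && e (i, j) || (j < i)%N && e (j, i).
Proof. by rewrite /adj inE. Qed.

Lemma adj_sym g i j : adj g i j = adj g j i.
Proof.
rewrite /adj; case: g => E /= /andP[_ /forallP/(_ i)/forallP/(_ j)].
by move=> /eqP.
Qed.

Lemma adj_irr g i : adj g i i = false.
Proof. by rewrite /adj; case: g => E /= /andP[/forallP/(_ i)/negPf]. Qed.

Lemma graph_of_eq e g :
  (graph_of e == g) = [forall p : 'I_n * 'I_n, (p.1 < p.2)%N ==> (e p == adj g p.1 p.2)].
Proof.
apply/eqP/forallP => [<- p|H].
  apply/implyP => lt_p; rewrite adj_graph_of lt_p [(p.2 < _)%N]ltnNge (ltnW lt_p).
  by rewrite /= orbF -surjective_pairing.
apply: val_inj; apply/setP => -[i j]; 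
suff : adj (graph_of e) i j = adj g i j by [].
rewrite adj_graph_of; case: (ltngtP i j) => [ij|ji|/val_inj ->] /=.
- by move/implyP: (H (i, j)) => /(_ ij) /eqP ->; rewrite orbF.
- by move/implyP: (H (j, i)) => /(_ ji) /eqP ->; rewrite adj_sym.
- by rewrite adj_irr.
Qed.

Lemma expect_graph_of (W : R -> R -> R) (x : n.-tuple R) g :
  expect (fun p => W (tnth x p.1) (tnth x p.2)) (fun e => (graph_of e == g)%:R) =
  edges_prob W x g.
Proof.
pose h (p : 'I_n * 'I_n) b : R := ((p.1 < p.2)%N ==> (b == adj g p.1 p.2))%:R.
rewrite (@expect_eq _ _ _ _ (fun e => \prod_p h p (e p))); last first.
  move=> e; rewrite graph_of_eq; case: (boolP [forall p, _]) => [/forallP H|].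
    by rewrite big1 // => p _; rewrite /h H.
  by rewrite negb_forall => /existsP[p /negPf pE]; rewrite (bigD1 p) //= /h pE mul0r.
rewrite expect_prod /edges_prob [RHS]big_mkcond; apply: eq_bigr => p _; rewrite /h.
case: (_ < _)%N => /=; last by rewrite !mulr1 addrC subrK.
by case: (adj g _ _); rewrite /= !(mulr0, mulr1) ?add0r ?addr0.
Qed.

(** Passage from the conditional law in [is_random_graph] to a finite Bernoulli expectation. *)
Lemma sum_edges_prob (W : R -> R -> R) (x : n.-tuple R) (A : pred (sgraph n)) :
  \sum_(g : {E : {set 'I_n * 'I_n} | is_sgraph E} | A g) edges_prob W x g =
  expect (fun p => W (tnth x p.1) (tnth x p.2)) (fun e => (A (graph_of e))%:R).
Proof.
under eq_bigr do rewrite -expect_graph_of.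
rewrite /expect -averages_sum; apply: averages_eq => e.
case: (boolP (A (graph_of e))) => Ae.
  rewrite (bigD1 (graph_of e)) //= eqxx big1 ?addr0 // => g /andP[_].
  by rewrite eq_sym => /negPf ->.
rewrite big1 // => g Ag; case: eqP => // eg.
by rewrite eg Ag in Ae.
Qed.

Variables (K : finType) (tau : 'I_n -> K) (c : K -> K -> R) (w : 'I_n * 'I_n -> R).
Variables (a : K -> nat) (r T : nat) (B l : R).
Hypothesis w01 : forall p, 0 <= w p < 1.
Hypothesis w_le : forall p : 'I_n * 'I_n, (p.1 < p.2)%N ->
  expR (- c (tau p.1) (tau p.2)) <= 1 - w p.
Hypothesis a_gt1 : forall k, (1 < a k)%N.
Hypothesis r_gt0 : (0 < r)%N.
Hypothesis n_gt0 : (0 < n)%N.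
Hypothesis B_gt0 : 0 < B.
Hypothesis l01 : 0 <= l <= 1.
Let s := (\sum_k a k)%N.
Hypothesis overlap : forall X : {set 'I_n},
  (forall k, #|of_type tau k X| <= a k)%N -> (1 < #|X|)%N ->
  expR (\sum_(p in pairs X) c (tau p.1) (tau p.2)) <= B^-1 * (r%:R / s%:R) ^+ #|X|.
Hypothesis T_large : forall k, (#|of_type tau k [set: 'I_n]| < T * a k + a k * r)%N.

Lemma independent_of_absent (S : {set K}) (v : parts a S -> 'I_r -> 'I_n) e f :
  absent (@pairs n \o transversal_of v) e f -> forall x y,
    x \in transversal_of v f -> y \in transversal_of v f -> ~~ adj (graph_of e) x y.
Proof.
move=> /forall_inP H x y xf yf; rewrite adj_graph_of negb_or !negb_and.
case: (ltngtP x y) => //= lt_xy; rewrite ?andbT; apply: H;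
  by rewrite inE lt_xy xf yf.
Qed.

Lemma card_of_type_transversal (S : {set K}) (v : parts a S -> 'I_r -> 'I_n) f k :
  respects_types tau v -> (#|of_type tau k (transversal_of v f)| <= a k)%N.
Proof.
move=> [vinj vtype].
pose p (t : 'I_((k \in S) * a k)) : parts a S := existT _ k t.
apply: (@leq_trans #|[set v (p t) (f (p t)) | t in setT]|).
  apply: subset_leq_card; apply/subsetP => x; rewrite inE => /andP[/imsetP[j _ ->]].
  rewrite vtype; case: j => k' t /= /eqP kk'; subst k'.
  by apply/imsetP; exists t.
apply: leq_trans (leq_imset_card _ _) _; rewrite cardsT card_ord.
by case: (k \in S); rewrite ?mul1n ?mul0n.
Qed.

(** The array is uncurried into a finite function so that the union bound can count arrays. *)
Definition bad_parts (S : {set K}) e (v : {ffun parts a S * 'I_r -> 'I_n}) : bool :=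
  [forall f, ~~ absent (@pairs n \o transversal_of (fun j x => v (j, x))) e f].

Lemma expect_bad_parts (S : {set K}) (v : {ffun parts a S * 'I_r -> 'I_n}) :
  S != set0 -> respects_types tau (fun j x => v (j, x)) ->
  expect w (fun e => (bad_parts e v)%:R) <=
    expR (- l * (B * expR (-1)) + l ^+ 2 * #|{: 'I_n * 'I_n}|%:R).
Proof.
move=> /set0Pn[k kS] vtau; case: (vtau) => vinj vtype.
apply: (@expect_no_transversal R n _ _ _ _ _ (fun x y => c (tau x) (tau y)) s) => //.
- apply: (@leq_trans #|'I_((k \in S) * a k)|); first by rewrite card_ord kS mul1n.
  pose p (t : 'I_((k \in S) * a k)) : parts a S := existT _ k t.
  have p_inj : injective p.
    by move=> t t' /(congr1 (fun j : parts a S => val (tagged j))) /= /val_inj.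
  by rewrite -(card_codom p_inj) max_card.
- exact: card_parts.
- move=> f X Xf X1; apply: overlap => // k'.
  apply: leq_trans (card_of_type_transversal f k' vtau).
  by apply: subset_leq_card; apply/subsetP => x; rewrite !inE => /andP[/(subsetP Xf) -> ->].
Qed.

(** Union bound: if greedy colouring fails, then for some nonempty set of types some array of parts
    has no independent transversal. There are at most 2^|K| sets of types and n^(s r) arrays for
    each. *)
Lemma expect_chromatic_number :
  expect w (fun e => (T + s * r < chromatic_number (graph_of e))%N%:R) <=
  (2 ^ #|K|)%:R * (n%:R ^+ (s * r) *
    expR (- l * (B * expR (-1)) + l ^+ 2 * #|{: 'I_n * 'I_n}|%:R)).
Proof.
set E := expR _.
pose ok (S : {set K}) (v : {ffun parts a S * 'I_r -> 'I_n}) :=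
  (S != set0) && `[< respects_types tau (fun j x => v (j, x)) >].
pose bad e := \sum_(S : {set K}) \sum_(v | ok S v) (bad_parts e v)%:R : R.
have bad_ge0 e S : 0 <= \sum_(v | ok S v) (bad_parts e v)%:R :> R by apply: sumr_ge0.
have w01' p : 0 <= w p <= 1 by case/andP: (w01 p) => -> /ltW.
apply: (@le_trans _ _ (expect w bad)).
  apply: expect_le => // e; case: ltnP => [|_] /=; last by apply: sumr_ge0 => S _; apply: bad_ge0.
  (* A count below 1 leaves no bad array, and then greedy colouring succeeds. *)
  rewrite ltnNge => /negP H; rewrite leNgt; apply/negP => bad_lt1; apply: H.
  apply: (chromatic_number_le _ r_gt0 _ T_large) => [k|S v S0 vtau]; first exact: ltnW.
  pose v' : {ffun parts a S * 'I_r -> 'I_n} := [ffun q => v q.1 q.2].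
  have v'E j x : v' (j, x) = v j x by rewrite ffunE.
  have v'tau : respects_types tau (fun j x => v' (j, x)).
    case: vtau => vinj vtype; split=> [j i x y|j x]; rewrite !v'E; last exact: vtype.
    exact: vinj.
  have [/forallP Hv|] := boolP (bad_parts e v').
    move: bad_lt1; rewrite /bad (bigD1 S) //= (bigD1 v') /=; last first.
      by rewrite /ok S0; apply/asboolP.
    have -> : bad_parts e v' by apply/forallP.
    rewrite -addrA gtrDl ltNge addr_ge0 //; first exact: sumr_ge0.
    by apply: sumr_ge0 => S' _; apply: bad_ge0.
  rewrite negb_forall => /existsP[f]; rewrite negbK => fabs; exists f => x y.
  have -> : transversal_of v f = transversal_of (fun j x => v' (j, x)) f.
    by apply: eq_imset => j; rewrite v'E.
  exact: independent_of_absent.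
rewrite /expect averages_sum.
apply: (@le_trans _ _ (\sum_(S : {set K}) n%:R ^+ (s * r) * E)); last first.
  have cK : #|{set K}| = (2 ^ #|K|)%N.
    by rewrite -[LHS]cardsT -powersetT card_powerset cardsT.
  by rewrite sumr_const cK mulr_natl.
apply: ler_sum => S _; rewrite averages_sum.
apply: (@le_trans _ _ (\sum_(v | ok S v) E)).
  by apply: ler_sum => v /andP[S0 /asboolP vtau]; apply: expect_bad_parts.
rewrite sumr_const -[leLHS]mulr_natl ler_wpM2r ?expR_ge0 // -natrX ler_nat.
apply: leq_trans (max_card _) _.
by rewrite card_ffun card_prod !card_ord leq_pexp2l // leq_mul2r card_parts orbT.
Qed.

End BlockModel.

(** * Asymptotics *)

Section QuadraticForm.
Import boot.fintype boot.finset.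
Variables (R : realType) (n : nat) (K : finType) (tau : 'I_n -> K) (c : K -> K -> R).
Hypothesis c_sym : forall j k, c j k = c k j.
Hypothesis c_ge0 : forall j k, 0 <= c j k.

Lemma sum_of_type (X : {set 'I_n}) (f : K -> R) :
  \sum_(x in X) f (tau x) = \sum_k #|of_type tau k X|%:R * f k.
Proof.
rewrite (partition_big tau xpredT) //=; apply: eq_bigr => k _.
rewrite (eq_bigr (fun=> f k)) => [|x /andP[_ /eqP -> //]].
rewrite sumr_const mulr_natl; congr (_ *+ _); apply: eq_card => x.
by rewrite !inE.
Qed.

(** As a sum over ordered pairs of [X], the right-hand side counts each unordered pair twice and
    adds a nonnegative diagonal. *)
Lemma sum_pairs_le (X : {set 'I_n}) :
  2 * (\sum_(p in pairs X) c (tau p.1) (tau p.2)) <=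
  \sum_k \sum_j c k j * #|of_type tau k X|%:R * #|of_type tau j X|%:R.
Proof.
have -> : \sum_k \sum_j c k j * #|of_type tau k X|%:R * #|of_type tau j X|%:R =
    \sum_(x in X) \sum_(y in X) c (tau x) (tau y).
  rewrite (sum_of_type X (fun k => \sum_(y in X) c k (tau y))).
  apply: eq_bigr => k _; rewrite (sum_of_type X (c k)) mulr_sumr.
  by apply: eq_bigr => j _; ring.
rewrite pair_big /= mulr_natl mulr2n.
rewrite [leRHS](bigID (fun p : 'I_n * 'I_n => (p.1 < p.2)%N)) /= lerD //.
  rewrite le_eqVlt; apply/orP; left; apply/eqP; apply: eq_bigl => p.
  by rewrite inE andbC.
pose sw (p : 'I_n * 'I_n) := (p.2, p.1).
rewrite [leRHS](reindex_inj (h := sw)) /=; last by move=> [? ?] [? ?] [-> ->].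
rewrite [leRHS](bigID (mem (pairs X))) /= -[leLHS]addr0 lerD //; last exact: sumr_ge0.
rewrite le_eqVlt; apply/orP; left; apply/eqP; apply: eq_big => [p|p _]; last by rewrite c_sym.
rewrite !inE -leqNgt; case: (ltngtP p.1 p.2) => _ /=;
by case: (p.1 \in X); case: (p.2 \in X).
Qed.

End QuadraticForm.

(* Few coincidences: the exponent is O(1) because it is quadratic in [x]; many
   coincidences: the exponent is beaten by the factor [1 - ep]. *)
Lemma exponent_le (R : realFieldType) (C ep d L x z : R) :
  1 <= L -> 0 < ep -> d <= ep / 4 -> d <= 32^-1 -> 64 * C <= L * ep ^+ 2 ->
  2 <= x -> z <= (1 - ep) * L * x -> 2 * z <= C * x ^+ 2 ->
  z <= - (7 / 4 * L) + (1 - 2 * d) * L * x.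
Proof.
move=> L1 ep_gt0 d_le1 d_le2 CL x2 zx zC.
have L0 : 0 <= L by lra.
have x_ge0 : 0 <= x by lra.
have [xl|xl] := leP 4 (ep * x).
  have H1 : d * (L * x) <= ep / 4 * (L * x) by apply: ler_wpM2r d_le1; exact: mulr_ge0.
  have H2 : 4 * L <= ep * x * L by apply: ler_wpM2r.
  by nra.
have zL : z <= L / 8.
  have [C0|C0] := leP 0 C; last first.
    have : C * x ^+ 2 <= 0 by rewrite mulr_le0_ge0 ?sqr_ge0 // ltW.
    by lra.
  have e2 : 0 < ep ^+ 2 by rewrite exprn_gt0.
  have H1 : (ep * x) ^+ 2 <= 4 ^+ 2.
    by rewrite lerXn2r ?nnegrE ?mulr_ge0 // ltW.
  have H2 := ler_wpM2l C0 H1.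
  have H3 := ler_wpM2r (ltW e2) zC.
  rewrite -(ler_pM2r e2); rewrite exprMn in H2.
  by lra.
have H1 : 2 * ((1 - 2 * d) * L) <= x * ((1 - 2 * d) * L).
  by apply: ler_wpM2r x2; apply: mulr_ge0; lra.
have H2 : d * L <= 32^-1 * L by apply: ler_wpM2r d_le2.
by lra.
Qed.

Section Asymptotics.
Import boot.fintype boot.finset.
Variables (R : realType) (K : finType) (c : K -> K -> R) (P : K -> R).
Variables (C Phi0 Phi1 Phi2 Phi3 : R).
Hypothesis c_sym : forall j k, c j k = c k j.
Hypothesis c_ge0 : forall j k, 0 <= c j k.
Hypothesis c_le : forall j k, c j k <= C.
Hypothesis P_gt0 : forall k, 0 < P k.
Hypothesis Phi0_ge0 : 0 <= Phi0.
Hypothesis Phi01 : Phi0 < Phi1.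
Hypothesis Phi12 : Phi1 < Phi2.
Hypothesis quadratic : forall y : K -> R, (forall k, 0 <= y k <= P k) ->
  \sum_k \sum_j c k j * y k * y j <= Phi0 * \sum_k y k.

(** Roles of the constants, with L = ln n: [Phi0] bounds the quadratic form, [Phi1] fixes the class
    size through [a k] close to (2L/Phi1) P k, [Phi2] the number of classes, about Phi2 n/(2L), and
    [Phi3] leaves room for the private colours. The gap between [Phi0] and [Phi1] is the gain [ep];
    parts have about n^(1-d) vertices, and c1 L bounds the size of a class. The bound d <= 1/32
    gives 2(1 - 2d) >= 7/4 + 1/8, as [exponent_le] requires when there are few coincidences. *)
Let ep : R := 1 - Phi0 / Phi1.
Let d : R := Num.min (ep / 4) 32^-1.
Let c1 : R := 2 * (\sum_k P k) / Phi1.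

Let Phi1_gt0 : 0 < Phi1. Proof. exact: le_lt_trans Phi01. Qed.
Let ep_gt0 : 0 < ep. Proof. by rewrite subr_gt0 ltr_pdivrMr // mul1r. Qed.
Let d_gt0 : 0 < d. Proof. by rewrite lt_min divr_gt0 //= invr_gt0. Qed.
Let d_le1 : d <= ep / 4. Proof. by rewrite ge_min lexx. Qed.
Let d_le2 : d <= 32^-1. Proof. by rewrite ge_min lexx orbT. Qed.

Section Overlap.
Variables (n : nat) (tau : 'I_n -> K) (a : K -> nat) (r : nat) (L : R).
Hypothesis L_ge1 : 1 <= L.
Hypothesis a_le : forall k, (a k)%:R <= 2 * L / Phi1 * P k.
Hypothesis a_gt0 : (0 < \sum_k a k)%N.
Hypothesis r_ge : expR ((1 - d) * L) <= 2 * r%:R.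
Hypothesis c1L : 2 * c1 * L <= expR (d * L).
Hypothesis CL : 64 * C <= L * ep ^+ 2.

Lemma sum_a_le : (\sum_k a k)%:R <= c1 * L.
Proof.
rewrite natr_sum /c1; apply: le_trans (ler_sum _ (fun k _ => a_le k)) _.
by rewrite -mulr_sumr le_eqVlt; apply/orP; left; apply/eqP; ring.
Qed.

(** Dividing the type counts of [X] by 2L/Phi1 gives a vector of the box, and rescaling the
    quadratic form turns [Phi0] into the exponent (1 - ep) L |X|. The crude bound C |X|^2 treats
    small [X]. On the other side, r/s is at least exp((1 - 2d) L): one factor exp(-dL) comes from r,
    another pays for the logarithmic s and the rounding of r. *)
Lemma overlap_le (X : {set 'I_n}) :
  (forall k, #|of_type tau k X| <= a k)%N -> (1 < #|X|)%N ->
  expR (\sum_(p in pairs X) c (tau p.1) (tau p.2)) <=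
    (expR (7 / 4 * L))^-1 * (r%:R / (\sum_k a k)%:R) ^+ #|X|.
Proof.
move=> Xa X1; set z := \sum_(p in pairs X) _; set s := (\sum_k a k)%N.
have L0 : 0 < L by apply: lt_le_trans L_ge1.
have s0 : 0 < s%:R :> R by rewrite ltr0n.
have x2 : 2 <= #|X|%:R :> R by rewrite ler_nat.
have z2 := sum_pairs_le tau c_sym c_ge0 X; rewrite -/z in z2.
pose kap : R := 2 * L / Phi1.
have kap0 : 0 < kap by rewrite divr_gt0 // mulr_gt0.
pose y k : R := #|of_type tau k X|%:R / kap.
have sumX : #|X|%:R = \sum_k #|of_type tau k X|%:R :> R.
  by rewrite (card_of_type tau X) natr_sum.
have zPhi : z <= (1 - ep) * L * #|X|%:R.
  rewrite [1 - ep](_ : _ = Phi0 / Phi1); last by rewrite /ep; ring.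
  have yP k : 0 <= y k <= P k.
    rewrite divr_ge0 ?(ltW kap0) //= ler_pdivrMr // mulrC; apply: le_trans (a_le k).
    by rewrite ler_nat.
  have := quadratic yP; rewrite -mulr_suml -sumX.
  have -> : \sum_k \sum_j c k j * y k * y j = kap ^- 2 *
      \sum_k \sum_j c k j * #|of_type tau k X|%:R * #|of_type tau j X|%:R.
    rewrite mulr_sumr; apply: eq_bigr => k _; rewrite mulr_sumr; apply: eq_bigr => j _.
    by rewrite /y; field; rewrite gt_eqF.
  rewrite mulrC ler_pdivrMr ?exprn_gt0 // => H.
  have {}H := le_trans z2 H.
  rewrite -(ler_pM2l (_ : 0 < 2)) //; apply: le_trans H _.
  rewrite le_eqVlt; apply/orP; left; apply/eqP; rewrite /kap; field.
  by rewrite !gt_eqF.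
have zC : 2 * z <= C * #|X|%:R ^+ 2.
  apply: le_trans z2 _; rewrite expr2 {1}sumX mulr_suml mulr_sumr; apply: ler_sum => k _.
  rewrite sumX !mulr_sumr; apply: ler_sum => j _.
  by rewrite -mulrA ler_wpM2r // mulr_ge0.
have zle := exponent_le L_ge1 ep_gt0 d_le1 d_le2 CL x2 zPhi zC.
apply: (@le_trans _ _ (expR (- (7 / 4 * L) + (1 - 2 * d) * L * #|X|%:R))).
  by rewrite ler_expR.
rewrite expRD expRN.
rewrite ler_wpM2l ?invr_ge0 ?expR_ge0 // expRM_natr lerXn2r ?nnegrE ?expR_ge0 ?divr_ge0 //.
rewrite ler_pdivlMr //.
apply: (@le_trans _ _ (expR ((1 - 2 * d) * L) * (c1 * L))).
  by rewrite ler_wpM2l ?expR_ge0 // sum_a_le.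
rewrite -(ler_pM2l (_ : 0 < 2)) //; apply: le_trans r_ge.
rewrite [(1 - d) * L](_ : _ = (1 - 2 * d) * L + d * L); last by ring.
rewrite expRD mulrCA ler_wpM2l ?expR_ge0 //.
by rewrite mulrA.
Qed.

End Overlap.


(** The side conditions on [L], which stands for ln n, are what the rounding, the leftover vertices
    and the union bound consume; all of them hold for large [L]. *)
Lemma expect_chromatic_le (n : nat) (tau : 'I_n -> K) (w : 'I_n * 'I_n -> R) (L : R) :
  expR L = n%:R -> 1 <= L ->
  (forall p, 0 <= w p < 1) ->
  (forall p : 'I_n * 'I_n, (p.1 < p.2)%N -> expR (- c (tau p.1) (tau p.2)) <= 1 - w p) ->
  (forall k, #|of_type tau k [set: 'I_n]|%:R <= P k * n%:R) ->
  (forall k, 2 <= 2 * L / Phi1 * P k) ->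
  (forall k, Phi2 / (2 * L) <= P k * ((Phi2 / Phi1 - 1) / 2)) ->
  2 * L / Phi1 <= (Phi2 / Phi1 - 1) / 2 * expR L ->
  2 * c1 * L <= expR (d * L) ->
  2 * c1 * L ^+ 2 <= (Phi3 - Phi2) * expR (d * L) ->
  64 * C <= L * ep ^+ 2 ->
  c1 * L ^+ 2 <= expR (L / 2 - 3) / 4 ->
  2 <= expR ((1 - d) * L) ->
  expect w (fun e => (Phi3 * expR L / (2 * L) < (chromatic_number (graph_of e))%:R)%R%:R)
    <= (2 ^ #|K|)%:R * expR (- (expR (3 / 2 * L - 3) / 4)).
Proof.
move=> nL L1 w01 w_le tau_le H1 H2 H3 H4 H5 H6 H7 H9.
have L0 : 0 < L by apply: lt_le_trans L1.
have Phi2_gt0 : 0 < Phi2 by apply: lt_trans Phi12.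
have n_gt0 : (0 < n)%N by rewrite -(ltr0n R) -nL expR_gt0.
pose Y k := 2 * L / Phi1 * P k.
pose X := Phi2 * expR L / (2 * L).
pose a k := Num.truncn (Y k).
pose r := Num.truncn (expR ((1 - d) * L)).
pose T := Num.truncn X.
have Y_ge0 k : 0 <= Y k by apply: le_trans (H1 k).
have X_ge0 : 0 <= X by rewrite divr_ge0 ?mulr_ge0 ?expR_ge0 ?(ltW L0) ?(ltW Phi2_gt0).
have a_le k : (a k)%:R <= Y k by rewrite truncn_le.
have a_gt k : Y k - 1 < (a k)%:R by rewrite ltrBlDr natr1 truncnS_gt.
have a_gt1 k : (1 < a k)%N by rewrite truncn_gt_nat; apply: H1.
have T_le : T%:R <= X by rewrite truncn_le.
have T_gt : X - 1 < T%:R by rewrite ltrBlDr natr1 truncnS_gt.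
have r_le : r%:R <= expR ((1 - d) * L) by rewrite truncn_le expR_ge0.
have r_gt0 : (0 < r)%N by rewrite truncn_gt0; apply: le_trans H9; rewrite ler1n.
have r_ge : expR ((1 - d) * L) <= 2 * r%:R.
  have : expR ((1 - d) * L) < r.+1%:R by rewrite truncnS_gt.
  have : 1 <= r%:R :> R by rewrite ler1n.
  by rewrite -natr1; lra.
have a_sum_gt0 : (0 < \sum_k a k)%N.
  by rewrite (bigD1 (tau (Ordinal n_gt0))) //= addn_gt0 (ltnW (a_gt1 _)).
have s_le := sum_a_le a_le.
have c1_ge0 : 0 <= c1.
  by rewrite -(ler_pM2r L0) mul0r; apply: le_trans s_le.
set s := (\sum_k a k)%N in s_le a_sum_gt0.
(* T a_k is at least (X - 1)(Y k - 1). The product X Y k exceeds P k n by the factor Phi2/Phi1, and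
   by [H2] and [H3] the corrections X and Y k each use up at most half of this surplus. *)
have T_large k : (#|of_type tau k [set: 'I_n]| < T * a k + a k * r)%N.
  apply: (@leq_ltn_trans (T * a k)); last first.
    by rewrite -[ltnLHS]addn0 ltn_add2l muln_gt0 r_gt0 (ltnW (a_gt1 k)).
  rewrite -(ler_nat R); apply: le_trans (tau_le k) _; rewrite natrM -nL.
  have E0 := expR_ge0 L.
  have XY : X * Y k = P k * expR L * (Phi2 / Phi1).
    by rewrite /X /Y; field; rewrite !gt_eqF.
  have X_le : X <= P k * ((Phi2 / Phi1 - 1) / 2) * expR L.
    by have := ler_wpM2r E0 (H2 k); rewrite /X mulrAC.
  have Y_le : Y k <= (Phi2 / Phi1 - 1) / 2 * expR L * P k.
    by rewrite /Y ler_wpM2r // ltW.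
  have TA : (X - 1) * (Y k - 1) <= T%:R * (a k)%:R.
    have := H1 k; rewrite -/(Y k) => Y2.
    have [X1|X1] := leP X 1.
      by apply: (@le_trans _ _ 0); rewrite ?mulr_ge0 // mulr_le0_ge0 //; lra.
    by apply: ler_pM; rewrite ?(ltW T_gt) ?(ltW (a_gt k)) //; lra.
  apply: le_trans TA; nra.
(* The leftover s r <= c1 L n^(1-d) fits between the bounds given by [Phi2] and [Phi3]. *)
have final : (T + s * r)%:R <= Phi3 * expR L / (2 * L).
  rewrite natrD natrM; apply: (@le_trans _ _ (X + c1 * L * expR ((1 - d) * L))).
    by apply: lerD => //; apply: ler_pM.
  have -> : Phi3 * expR L / (2 * L) = X + (Phi3 - Phi2) * expR L / (2 * L).
    by rewrite /X; field; rewrite gt_eqF.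
  rewrite lerD2l ler_pdivlMr ?mulr_gt0 //.
  have -> : expR L = expR (d * L) * expR ((1 - d) * L).
    by rewrite -expRD; congr expR; ring.
  rewrite mulrA; apply: le_trans (ler_wpM2r (expR_ge0 _) H5).
  by rewrite le_eqVlt; apply/orP; left; apply/eqP; ring.
(* Of order n^(-1/4), to balance l n^(7/4) against l^2 n^2. The factor e^-2 makes the linear term
   exp(3L/2 - 3) and the quadratic one smaller by a factor e. *)
pose l := expR (- (L / 4) - 2).
have l01 : 0 <= l <= 1.
  by rewrite expR_ge0 -[leRHS]expR0 ler_expR; lra.
apply: (@le_trans _ _ (expect w (fun e => (T + s * r < chromatic_number (graph_of e))%N%:R))).
  apply: expect_le => [p|e]; first by case/andP: (w01 p) => -> /ltW.
  case: ltP => [lt_chi|_]; last exact: ler0n.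
  by rewrite -(ltr_nat R) (le_lt_trans final lt_chi).
have over := overlap_le L1 a_le a_sum_gt0 r_ge H4 H6.
have E := expect_chromatic_number w01 w_le a_gt1 r_gt0 n_gt0 (expR_gt0 (7 / 4 * L)) l01 (over _ _) T_large.
apply: le_trans E _.
rewrite ler_wpM2l // -nL -expRM_natr -expRD ler_expR.
rewrite card_prod card_ord [(n * n)%:R]natrM -nL -/s.
have -> : - l * (expR (7 / 4 * L) * expR (-1)) = - expR (3 / 2 * L - 3).
  by rewrite /l mulNr -!expRD; congr (- expR _); field.
have -> : l ^+ 2 * (expR L * expR L) = expR (3 / 2 * L - 3) * expR (-1).
  by rewrite /l -expRM_natr -!expRD; congr expR; field.
have e1 : expR (-1) <= 1 / 2 :> R.
  rewrite expRN -[1 / 2]invrK lef_pV2 ?posrE ?expR_gt0 ?invr_gt0 ?divr_gt0 //.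
  by have := @expR_ge1Dx R 1; lra.
have E0 := expR_ge0 (3 / 2 * L - 3).
have H8 := ler_wpM2l E0 e1.
(* Of the main term exp(3L/2 - 3), the quadratic term takes at most one half and the union bound
   n^(s r) one quarter; one quarter is left. *)
suff : L * (s * r)%:R <= expR (3 / 2 * L - 3) / 4 by lra.
have -> : expR (3 / 2 * L - 3) / 4 = expR L * (expR (L / 2 - 3) / 4).
  by rewrite mulrA -expRD; congr (expR _ / 4); field.
apply: le_trans (ler_wpM2l (expR_ge0 _) H7).
apply: (@le_trans _ _ (L * (c1 * L * expR L))); last first.
  by rewrite le_eqVlt; apply/orP; left; apply/eqP; ring.
rewrite ler_wpM2l ?(ltW L0) // natrM; apply: ler_pM => //.
apply: le_trans r_le _; rewrite ler_expR -[leRHS]mul1r ler_wpM2r ?(ltW L0) //.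
by have := d_gt0; lra.
Qed.

End Asymptotics.

(** The largeness conditions involving exponentials reduce to this comparison. Cube exp(y) >= y at y
    = dL/3: the cube of L outgrows its square. *)
Lemma near_sqr_le_expR (R : realType) (k d : R) : 0 < d ->
  \forall L \near +oo%R, k * L ^+ 2 <= expR (d * L).
Proof.
move=> d0; near=> L.
have L0 : 0 <= L by near: L; apply: nbhs_pinfty_ge; rewrite num_real.
have Lk : k * (d / 3) ^- 3 <= L by near: L; apply: nbhs_pinfty_ge; rewrite num_real.
have y0 : 0 <= d * L / 3 by rewrite divr_ge0 ?mulr_ge0 // ltW.
apply: (@le_trans _ _ ((d * L / 3) ^+ 3)).
  have -> : (d * L / 3) ^+ 3 = L * (d / 3) ^+ 3 * L ^+ 2 by field.
  rewrite ler_wpM2r ?sqr_ge0 //.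
  by rewrite -ler_pdivrMr // exprn_gt0 // divr_gt0.
rewrite [leRHS](_ : _ = expR (3%:R * (d * L / 3))); last by congr expR; field.
rewrite expRM_natl lerXn2r ?nnegrE ?expR_ge0 //.
by apply: le_trans (expR_ge1Dx _); rewrite lerDr.
Unshelve. all: by end_near.
Qed.

Lemma cvg_ln_pinfty (R : realType) : (ln (n%:R : R) @[n --> \oo] --> +oo%R)%classic.
Proof.
apply/cvgryPge => A; near=> n.
have An : expR A <= n%:R by near: n; exact: (cvgryPge _).1 (@cvgr_idn R) _.
by rewrite -[A]expRK ler_ln // posrE ?expR_gt0 // (lt_le_trans _ An) ?expR_gt0.
Unshelve. all: by end_near.
Qed.

Section NearInfinity.
Import boot.fintype boot.finset.
Variables (R : realType) (K : finType) (c : K -> K -> R) (P : K -> R).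
Variables (C p0 Phi0 Phi1 Phi2 Phi3 : R).
Hypothesis c_sym : forall j k, c j k = c k j.
Hypothesis c_ge0 : forall j k, 0 <= c j k.
Hypothesis c_le : forall j k, c j k <= C.
Hypothesis p0_gt0 : 0 < p0.
Hypothesis P_ge : forall k, p0 <= P k.
Hypothesis Phi0_ge0 : 0 <= Phi0.
Hypothesis Phi01 : Phi0 < Phi1.
Hypothesis Phi12 : Phi1 < Phi2.
Hypothesis Phi23 : Phi2 < Phi3.
Hypothesis quadratic : forall y : K -> R, (forall k, 0 <= y k <= P k) ->
  \sum_k \sum_j c k j * y k * y j <= Phi0 * \sum_k y k.

(** [tau] and [w] are quantified after [n]: the threshold must not depend on the sampled types,
    which vary with the outcome. *)
Lemma near_expect_chromatic_le (eta : R) : 0 < eta ->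
  \forall n \near \oo%classic, forall (tau : 'I_n -> K) (w : 'I_n * 'I_n -> R),
  (forall p, 0 <= w p < 1) ->
  (forall p : 'I_n * 'I_n, (p.1 < p.2)%N -> expR (- c (tau p.1) (tau p.2)) <= 1 - w p) ->
  (forall k, #|of_type tau k [set: 'I_n]|%:R <= P k * n%:R) ->
  expect w (fun e => (Phi3 * n%:R / (2 * ln n%:R) < (chromatic_number (graph_of e))%:R)%R%:R)
    <= eta.
Proof.
move=> eta0.
have P_gt0 k : 0 < P k by apply: lt_le_trans (P_ge k).
have Phi1_gt0 : 0 < Phi1 by apply: le_lt_trans Phi01.
set ep : R := 1 - Phi0 / Phi1; set d : R := Num.min (ep / 4) 32^-1.
set c1 : R := 2 * (\sum_k P k) / Phi1.
have ep_gt0 : 0 < ep by rewrite subr_gt0 ltr_pdivrMr // mul1r.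
have d_gt0 : 0 < d by rewrite lt_min divr_gt0 //= invr_gt0.
have d_le : d <= 32^-1 by rewrite ge_min lexx orbT.
have q_gt0 : 0 < Phi2 / Phi1 - 1 by rewrite subr_gt0 ltr_pdivlMr // mul1r.
have Phi32 : 0 < Phi3 - Phi2 by rewrite subr_gt0.
(* The conditions are treated for a real [L] tending to infinity, then specialised to ln n. *)
pose Q (L : R) : Prop := forall (n : nat) (tau : 'I_n -> K) (w : 'I_n * 'I_n -> R),
    expR L = n%:R -> (forall p, 0 <= w p < 1) ->
    (forall p : 'I_n * 'I_n, (p.1 < p.2)%N -> expR (- c (tau p.1) (tau p.2)) <= 1 - w p) ->
    (forall k, #|of_type tau k [set: 'I_n]|%:R <= P k * n%:R) ->
    expect w (fun e => (Phi3 * expR L / (2 * L) < (chromatic_number (graph_of e))%:R)%R%:R)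
      <= eta.
suff H : \forall L \near +oo%R, Q L.
  near=> n => tau w w01 w_le tau_le.
  have n0 : (0 < n)%N by near: n; exact: nbhs_infty_gt.
  have nL : expR (ln n%:R) = n%:R :> R by rewrite lnK // posrE ltr0n.
  have Qn : Q (ln n%:R) by near: n; exact: cvg_ln_pinfty H.
  by have := Qn n tau w nL w01 w_le tau_le; rewrite nL.
near=> L => n tau w nL w01 w_le tau_le.
have L1 : 1 <= L by near: L; apply: nbhs_pinfty_ge; rewrite num_real.
have L0 : 0 < L by apply: lt_le_trans L1.
have LL : L <= L ^+ 2 by rewrite expr2 -[leLHS]mulr1 ler_wpM2l // ltW.
have c1_ge0 : 0 <= c1.
  by rewrite /c1 divr_ge0 ?(ltW Phi1_gt0) // mulr_ge0 // sumr_ge0 // => k _; apply: ltW.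
have E := expect_chromatic_le c_sym c_ge0 c_le P_gt0 Phi0_ge0 Phi01 Phi12
  quadratic nL L1 w01 w_le tau_le.
apply: (@le_trans _ _ ((2 ^ #|K|)%:R * expR (- (expR (3 / 2 * L - 3) / 4)))).
  apply: E; rewrite -/ep -/d -/c1.
- move=> k; apply: (@le_trans _ _ (2 * L / Phi1 * p0)); last first.
    by rewrite ler_wpM2l // divr_ge0 // ?mulr_ge0 // ltW.
  have h : Phi1 / p0 <= L by near: L; apply: nbhs_pinfty_ge; rewrite num_real.
  rewrite ler_pdivrMr // in h.
  have -> : 2 * L / Phi1 * p0 = 2 * (L * p0 / Phi1) by ring.
  by rewrite -[leLHS]mulr1 ler_wpM2l // ler_pdivlMr // mul1r.
- move=> k; apply: (@le_trans _ _ (p0 * ((Phi2 / Phi1 - 1) / 2))); last first.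
    by rewrite ler_wpM2r // divr_ge0 // ltW.
  rewrite ler_pdivrMr ?mulr_gt0 //.
  have -> : p0 * ((Phi2 / Phi1 - 1) / 2) * (2 * L) = L * (p0 * (Phi2 / Phi1 - 1)) by field; rewrite gt_eqF.
  have h : Phi2 / (p0 * (Phi2 / Phi1 - 1)) <= L.
    by near: L; apply: nbhs_pinfty_ge; rewrite num_real.
  by rewrite ler_pdivrMr ?mulr_gt0 in h.
- have : 4 / (Phi1 * (Phi2 / Phi1 - 1)) * L ^+ 2 <= expR (1 * L).
    by near: L; apply: near_sqr_le_expR.
  rewrite mul1r => H.
  apply: le_trans (ler_wpM2l _ H); last by rewrite divr_ge0 // ltW.
  have -> : (Phi2 / Phi1 - 1) / 2 * (4 / (Phi1 * (Phi2 / Phi1 - 1)) * L ^+ 2) = 2 / Phi1 * L ^+ 2.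
    by field; rewrite gt_eqF //= gt_eqF //; have := Phi12; lra.
  by rewrite mulrAC ler_wpM2l // divr_ge0 // ltW.
- apply: (@le_trans _ _ (2 * c1 * L ^+ 2)).
    by rewrite ler_wpM2l // mulr_ge0.
  by near: L; apply: near_sqr_le_expR.
- rewrite -ler_pdivrMl // mulrA.
  by near: L; apply: near_sqr_le_expR.
- have h : 64 * C / ep ^+ 2 <= L by near: L; apply: nbhs_pinfty_ge; rewrite num_real.
  by rewrite ler_pdivrMr ?exprn_gt0 in h.
- have : 4 * expR 3 * c1 * L ^+ 2 <= expR (2^-1 * L).
    by near: L; apply: near_sqr_le_expR.
  rewrite [expR (L / 2 - 3)]expRD expRN [L / 2]mulrC => H.
  rewrite -mulrA -invfM ler_pdivlMr ?mulr_gt0 ?expR_gt0 //.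
  by apply: le_trans H; rewrite le_eqVlt; apply/orP; left; apply/eqP; ring.
- apply: (@le_trans _ _ (2 * L ^+ 2)).
    by rewrite -[leLHS]mulr1 ler_wpM2l // (le_trans L1).
  near: L; apply: near_sqr_le_expR; lra.
set N : R := (2 ^ #|K|)%:R.
have H : N * 4 * expR 3 / eta * L ^+ 2 <= expR (3 / 2 * L).
  by near: L; apply: near_sqr_le_expR.
have N0 : 0 <= N by apply: ler0n.
have y0 : 0 < expR (3 / 2 * L - 3) / 4 by rewrite divr_gt0 ?expR_gt0.
apply: (@le_trans _ _ (N * (expR (3 / 2 * L - 3) / 4)^-1)).
  rewrite ler_wpM2l // expRN lef_pV2 ?posrE ?expR_gt0 //.
  by apply: le_trans (expR_ge1Dx _); rewrite lerDr.
rewrite ler_pdivrMr // [expR (3 / 2 * L - 3)]expRD expRN.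
rewrite -(ler_pM2l (_ : 0 < 4 * expR 3 / eta)); last first.
  by rewrite divr_gt0 // mulr_gt0 // expR_gt0.
have -> : 4 * expR 3 / eta * (eta * (expR (3 / 2 * L) / expR 3 / 4)) = expR (3 / 2 * L).
  by field; rewrite !gt_eqF ?expR_gt0.
apply: le_trans H.
have -> : 4 * expR 3 / eta * N = N * 4 * expR 3 / eta by field; rewrite gt_eqF.
rewrite -[leLHS]mulr1 ler_wpM2l ?(le_trans L1) //.
by rewrite divr_ge0 ?(ltW eta0) // mulr_ge0 ?expR_ge0 // mulr_ge0.
Unshelve. all: by end_near.
Qed.

End NearInfinity.

(** * Quadratic forms on boxes *)

Section Rounding.
Import boot.fintype boot.finset.
Variables (R : realType) (K : finType) (c : K -> K -> R) (p : K -> R).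
Hypothesis c_ge0 : forall j k, 0 <= c j k.
Hypothesis p_ge0 : forall k, 0 <= p k.

Lemma expect_coord_set (w : K -> R) (S : {set K}) :
  expect w (fun e => \prod_(k in S) (e k)%:R) = \prod_(k in S) w k.
Proof.
pose h (i : K) (b : bool) : R := if i \in S then b%:R else 1.
transitivity (expect w (fun e => \prod_i h i (e i))).
  by apply: expect_eq => e; rewrite big_mkcond.
rewrite (expect_prod w h) [RHS]big_mkcond; apply: eq_bigr => k _; rewrite /h.
by case: (k \in S); rewrite !(mulr0, mulr1) ?addr0 // addrC subrK.
Qed.

Lemma expect_coord (w : K -> R) k : expect w (fun e => (e k)%:R) = w k.
Proof.
have := expect_coord_set w [set k]; rewrite big_set1 => <-.
by apply: expect_eq => e; rewrite big_set1.
Qed.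

(* Round [y] at random to a vertex of the box, coordinatewise and
   independently: this preserves the linear form on average and, the diagonal
   of [c] being nonnegative, does not decrease the quadratic form. *)
Lemma quadratic_box (Phi : R) :
  (forall B : {set K}, \sum_(k in B) \sum_(j in B) c k j * p k * p j <=
     Phi * \sum_(k in B) p k) ->
  forall y : K -> R, (forall k, 0 <= y k <= p k) ->
  \sum_k \sum_j c k j * y k * y j <= Phi * \sum_k y k.
Proof.
move=> HB y yp; pose w k := y k / p k.
have wp k : p k * w k = y k.
  rewrite /w mulrC; have [pk|pk] := eqVneq (p k) 0; last by rewrite divfK.
  by have := yp k; rewrite pk mulr0 -eq_le => /eqP.
have w01 k : 0 <= w k <= 1.
  have /andP[y0 yle] := yp k; rewrite divr_ge0 //=.
  have [pk|pk] := eqVneq (p k) 0; first by rewrite /w pk invr0 mulr0.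
  by rewrite ler_pdivrMr ?mul1r // lt_neqAle eq_sym pk p_ge0.
pose F (e : {ffun K -> bool}) := \sum_k \sum_j (c k j * p k * p j) * ((e k)%:R * (e j)%:R).
pose G (e : {ffun K -> bool}) := Phi * \sum_k p k * (e k)%:R.
have FG : expect w F <= expect w G.
  apply: expect_le => // e; rewrite /F /G.
  have := HB [set k | e k]; rewrite [X in X <= _]big_mkcond [X in _ <= _ * X]big_mkcond /=.
  congr (_ <= Phi * _).
    apply: eq_bigr => k _; rewrite inE; case: (e k) => /=; last first.
      by rewrite big1 // => j _; rewrite mul0r mulr0.
    rewrite big_mkcond; apply: eq_bigr => j _; rewrite inE mul1r.
    by case: (e j); rewrite ?mulr1 ?mulr0.
  by apply: eq_bigr => k _; rewrite inE; case: (e k); rewrite ?mulr1 ?mulr0.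
have <- : expect w G = Phi * \sum_k y k.
  rewrite /expect averagesZ averages_sum; congr (_ * _); apply: eq_bigr => k _.
  by rewrite averagesZ -/(expect w _) expect_coord wp.
apply: le_trans FG; rewrite /expect averages_sum; apply: ler_sum => k _.
rewrite averages_sum; apply: ler_sum => j _; rewrite averagesZ -/(expect w _).
have -> : c k j * y k * y j = (c k j * p k * p j) * (w k * w j).
  by rewrite -!wp; ring.
rewrite ler_wpM2l ?mulr_ge0 //.
have [<-|kj] := eqVneq k j.
  rewrite (@expect_eq _ _ _ _ (fun e => (e k)%:R)); last first.
    by move=> e; case: (e k); rewrite ?mulr0 ?mulr1.
  by rewrite expect_coord; have /andP[? ?] := w01 k; rewrite -[leRHS]mulr1 ler_wpM2l.
have := expect_coord_set w [set k; j]; rewrite big_setU1 ?big_set1 ?inE //= => <-.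
by rewrite le_eqVlt (@expect_eq _ _ _ _ (fun e => (e k)%:R * (e j)%:R)) ?eqxx // => e;
  rewrite big_setU1 ?big_set1 ?inE.
Qed.

Variables (C p0 : R).
Hypothesis c_le : forall j k, c j k <= C.
Hypothesis p0_ge0 : 0 <= p0.

(** Truncating [y] at [p] costs at most C p0 (y k + y j) in each entry, a linear error that a
    slightly larger Phi absorbs. The enlarged box has two uses: sampled type frequencies may exceed
    [p], and types of measure zero receive the positive density [p0]. *)
Lemma quadratic_box_enlarged (Phi Phi' : R) : 0 <= Phi ->
  2 * C * p0 * #|K|%:R <= Phi' - Phi ->
  (forall y : K -> R, (forall k, 0 <= y k <= p k) ->
     \sum_k \sum_j c k j * y k * y j <= Phi * \sum_k y k) ->
  forall y : K -> R, (forall k, 0 <= y k <= p k + p0) ->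
  \sum_k \sum_j c k j * y k * y j <= Phi' * \sum_k y k.
Proof.
move=> Phi0 CPhi H y yp; pose z k := Num.min (y k) (p k).
have zP k : [/\ 0 <= z k, z k <= p k, z k <= y k & y k <= z k + p0].
  have /andP[y0 yle] := yp k; rewrite /z le_min ge_min lexx orbT ge_min lexx p_ge0 y0.
  by split=> //; case: (leP (y k) (p k)) => _ //; rewrite lerDl.
have Hz := H z (fun k => _).
have {}Hz : \sum_k \sum_j c k j * z k * z j <= Phi * \sum_k z k.
  by apply: Hz => k; case: (zP k) => -> -> _ _.
have S0 : 0 <= \sum_k y k by apply: sumr_ge0 => k _; case/andP: (yp k).
have zy : \sum_k z k <= \sum_k y k by apply: ler_sum => k _; case: (zP k).
have step : \sum_k \sum_j c k j * y k * y j <=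
    \sum_k \sum_j c k j * z k * z j + \sum_k \sum_j C * p0 * (y k + y j).
  rewrite -big_split; apply: ler_sum => k _; rewrite -big_split; apply: ler_sum => j _ /=.
  case: (zP k) => zk0 _ zk1 zk2; case: (zP j) => zj0 _ zj1 zj2.
  have H1 : y k * y j - z k * z j <= p0 * (y k + y j).
    have h1 : (y k - z k) * y j <= p0 * y j.
      by rewrite ler_wpM2r ?(le_trans zj0 zj1) // lerBlDl.
    have h2 : z k * (y j - z j) <= y k * p0.
      by rewrite ler_pM // ?subr_ge0 // lerBlDl.
    by lra.
  have y0 : 0 <= p0 * (y k + y j) by rewrite mulr_ge0 // addr_ge0 ?(le_trans zk0 zk1) ?(le_trans zj0 zj1).
  have := ler_wpM2l (c_ge0 k j) H1; have := ler_wpM2r y0 (c_le k j).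
  by lra.
apply: le_trans step _.
have -> : \sum_k \sum_j C * p0 * (y k + y j) = (2 * C * p0 * #|K|%:R) * \sum_k y k.
  have E k : \sum_j C * p0 * (y k + y j) = C * p0 * (#|K|%:R * y k + \sum_j y j).
    by rewrite -mulr_sumr big_split /= sumr_const mulr_natl.
  under eq_bigr do rewrite E.
  by rewrite -mulr_sumr big_split /= -mulr_sumr sumr_const -[X in _ + X]mulr_natl; ring.
apply: le_trans (lerD Hz (ler_wpM2r S0 CPhi)) _.
by have := ler_wpM2l Phi0 zy; lra.
Qed.

End Rounding.

(** * Darboux sums and types *)

Local Open Scope classical_set_scope.
Local Open Scope ring_scope.

Section FiniteTypes.
Variables (d : measure_display) (T : measurableType d) (R : realType).
Variables (mu : {measure set T -> \bar R}) (K : finType) (tau : T -> K).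
Hypothesis mtau : forall k, measurable (tau @^-1` [set k]).

Lemma measurable_preimage_types (B : set K) : measurable (tau @^-1` B).
Proof.
have -> : tau @^-1` B = \bigcup_(k in B) (tau @^-1` [set k]).
  apply/seteqP; split=> [x Bx|x [k Bk] /= -> //].
  by exists (tau x).
by apply: fin_bigcup_measurable => // k _.
Qed.

Lemma measurable_fun_types (d' : measure_display) (U : measurableType d') (D : set T)
  (h : K -> U) : measurable_fun D (h \o tau).
Proof.
move=> mD Y mY; apply: measurableI => //.
exact: (measurable_preimage_types (h @^-1` Y)).
Qed.

Lemma integral_types (D : set T) (h : K -> \bar R) : measurable D ->
  (forall k, 0 <= h k)%E ->
  (\int[mu]_(x in D) h (tau x) =
   \sum_k h k * mu (D `&` tau @^-1` [set k]))%E.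
Proof.
move=> mD h0.
transitivity (\int[mu]_(x in D) (\sum_k h k * (\1_(tau @^-1` [set k]) x)%:E))%E.
  apply: eq_integral => x _; rewrite (bigD1 (tau x)) //= indicE mem_set // mule1.
  rewrite big1 ?adde0 // => k /eqP kx; rewrite indicE memNset ?mule0 //.
  by move=> /= xk; apply: kx.
rewrite ge0_integral_sum //; first last.
- by move=> k x _; rewrite mule_ge0 // lee_fin.
- move=> k; apply: emeasurable_funM => //.
  apply/measurable_EFinP; apply: measurable_indic => //.
apply: eq_bigr => k _; rewrite ge0_integralZl //.
  by rewrite integral_indic // setIC.
apply/measurable_EFinP; apply: measurable_indic => //.
Qed.

End FiniteTypes.

Section IteratedIntegral.
Variables (R : realType).
Notation mu := (@lebesgue_measure R).

Lemma integral_iterated (S : set R) (f : R * R -> \bar R) : measurable S ->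
  measurable_fun (S `*` S) f -> (forall p, (S `*` S) p -> 0 <= f p)%E ->
  (\int[mu]_(x in S) \int[mu]_(y in S) f (x, y) =
   \int[mu \x mu]_(p in S `*` S) f p)%E.
Proof.
move=> mS mf f0; have mSS : measurable (S `*` S) by exact: measurableX.
rewrite [RHS]integral_mkcond fubini_tonelli1; last 2 first.
- by apply/(measurable_restrictT _ mSS).
- move=> p; rewrite patchE; case: ifPn => // pS; apply: f0.
  by rewrite inE in pS.
rewrite [LHS]integral_mkcond; apply: eq_integral => x _.
rewrite patchE /fubini_F; case: ifPn => xS.
  rewrite [LHS]integral_mkcond; apply: eq_integral => y _.
  rewrite !patchE; congr (if _ then _ else _).
  by rewrite in_setX /= xS.
rewrite integral0_eq // => y _; rewrite patchE; case: ifPn => //.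
by rewrite in_setX /= (negPf xS).
Qed.

End IteratedIntegral.

Section Cells.
Variable (R : realType).
Implicit Types (s : seq R) (x : R).

(** A partition lists right endpoints, so within [0, 1] the cells are half-open on the left, except
    that the first also contains 0, and unlike the closed Darboux cells they do not overlap. Points
    to the right of 1 get the index [size s]. *)
Definition cell s x : nat := find (fun z => x <= z) s.

Lemma measurable_cell s i : measurable (cell s @^-1` [set i]).
Proof.
elim: s i => [|z s IHs] i.
  case: i => [|i].
    rewrite [X in measurable X](_ : _ = setT) //.
    by apply/seteqP; split.
  rewrite [X in measurable X](_ : _ = set0) //.
  by apply/seteqP; split.
have mz : measurable [set x : R | x <= z] by rewrite -set_itvNyc; apply: measurable_itv.
case: i => [|i].
  rewrite [X in measurable X](_ : _ = [set x : R | x <= z]) //.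
  by apply/seteqP; split => x; rewrite /cell /=; case: (x <= z).
rewrite [X in measurable X](_ : _ = ~` [set x : R | x <= z] `&` cell s @^-1` [set i]).
  by apply: measurableI => //; apply: measurableC.
apply/seteqP; split => x; rewrite /cell /=; case: (x <= z) => //=.
- by move=> [->]; split.
- by case.
- by case=> _ ->.
Qed.

Variable s : seq R.
Hypothesis s01 : itv_partition 0 1 s.

Lemma cell_lt x : x <= 1 -> (cell s x < size s)%N.
Proof.
move=> x1; rewrite -has_find; apply/hasP; exists 1 => //.
case: s01 => _ /eqP l1; case: s l1 => [/eqP|z s' /= <-]; last exact: mem_last.
by rewrite /= eq_sym oner_eq0.
Qed.

Lemma division_cell x : x \in `[0, 1] ->
  x \in `[division s (cell s x), division s (cell s x).+1].
Proof.
rewrite !in_itv /= => /andP[x0 x1]; have xs := cell_lt x1.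
rewrite /division [nth 1 (0 :: s) (cell s x).+1]/=.
have := @nth_find _ 1 (fun z => x <= z) s; rewrite has_find xs => -> //; rewrite andbT.
case E : (cell s x) => [|i] //=; apply: ltW; rewrite ltNge; apply/negbT.
by apply: (@before_find _ 1 (fun z => x <= z)); rewrite -/(cell s x) E.
Qed.

Lemma division_le_mono i j : (i <= j)%N -> division s i <= division s j.
Proof.
move=> ij; have [js|sj] := ltnP j (size s).+1; last first.
  rewrite {2}/division nth_default //.
  have [is_|si] := ltnP i (size s).+1; last by rewrite /division nth_default.
  exact: itv_partition_nth_le.
have ss : sorted <=%O (0 :: s).
  by case: s01 => p _; apply: sub_path p => ? ?; exact: ltW.
apply: (sorted_leq_nth le_trans le_refl 1 ss) => //=; rewrite inE //.
exact: leq_ltn_trans ij js.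
Qed.

Lemma division_itv i : 0 <= division s i <= 1.
Proof.
have [js|sj] := ltnP i (size s).+1; last first.
  by rewrite /division nth_default // ler01 lexx.
by rewrite itv_partition_nth_ge ?itv_partition_nth_le.
Qed.

Lemma division_cell_lt x : (0 < cell s x)%N -> division s (cell s x) < x.
Proof.
rewrite /division; case E : (cell s x) => [|i] //= _; rewrite ltNge; apply/negbT.
by apply: (@before_find _ 1 (fun z => x <= z)); rewrite -/(cell s x) E.
Qed.

(** [BSide true] closes the left end, which happens for the first cell only. *)
Lemma cell_setE i : (i < size s)%N ->
  `[0, 1] `&` cell s @^-1` [set i] =
  [set` Interval (BSide (i == 0)%N (division s i)) (BRight (division s i.+1))].
Proof.
move=> isz; apply/seteqP; split => x.
  move=> [x01 <-] /=; have := division_cell x01; rewrite !in_itv /= => /andP[x0 ->].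
  rewrite andbT; case: eqP => // /eqP; rewrite -lt0n => /division_cell_lt.
  by [].
rewrite /= in_itv /= => /andP[ix xi].
have di := division_itv i; have dS := division_itv i.+1.
have x01 : x \in `[0, 1].
  rewrite in_itv /= (le_trans xi) ?andbT; last by case/andP: dS.
  by case/andP: di => d0 _; move: ix; case: eqP => _ /= => [|/ltW]; apply: le_trans.
split=> //=; have := division_cell x01; rewrite in_itv /= => /andP[_ xc].
apply/eqP; rewrite eqn_leq; apply/andP; split; rewrite leqNgt; apply/negP => lt_i.
  have := division_cell_lt (leq_ltn_trans (leq0n _) lt_i).
  by apply/negP; rewrite -leNgt (le_trans xi) // division_le_mono.
have i0 : (i == 0%N) = false by apply: gtn_eqF; apply: leq_ltn_trans lt_i.
move: ix; rewrite i0 /= ltNge => /negP; apply.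
by apply: le_trans xc _; apply: division_le_mono.
Qed.

Lemma division_default i : (size s <= i)%N -> division s i = 1.
Proof.
move=> si; apply/eqP; rewrite eq_le; apply/andP; split.
  by case/andP: (division_itv i).
apply: le_trans (division_le_mono si).
by rewrite /division (itv_partition_nth_size _ s01).
Qed.

Lemma measure_cell i :
  lebesgue_measure (`[0, 1] `&` cell s @^-1` [set i]) =
  (division s i.+1 - division s i)%:E.
Proof.
have [isz|szi] := ltnP i (size s).
  rewrite cell_setE // lebesgue_measure_itv /= lte_fin.
  have := division_le_mono (leqnSn i); rewrite le_eqVlt => /orP[/eqP ->|-> //].
  by rewrite ltxx subrr.
rewrite !division_default ?subrr //; last exact: leqW.
rewrite (_ : _ `&` _ = set0) ?measure0 //; apply/seteqP; split=> // x [/=].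
rewrite in_itv /= => /andP[_ /cell_lt + xi].
by rewrite xi ltnNge szi.
Qed.

End Cells.

Section CellTypes.
Variable R : realType.
Notation mu := (@lebesgue_measure R).
Notation Q := (`[0, 1]%classic : set R).
Implicit Types s t : seq R.

(** One index beyond the cells receives the points to the right of 1, which makes the type total on
    [R]; it has measure zero in [0, 1]. *)
Definition cell_type s x : 'I_(size s).+1 := inord (cell s x).

Lemma cell_typeE s x : cell_type s x = cell s x :> nat.
Proof. by rewrite inordK // ltnS find_size. Qed.

Lemma cell_type_preimage s k : cell_type s @^-1` [set k] = cell s @^-1` [set (k : nat)].
Proof.
apply/seteqP; split => x /=; first by move=> <-; rewrite cell_typeE.
by move=> xk; apply: val_inj; rewrite /= cell_typeE.
Qed.

Lemma measurable_cell_type s k : measurable (cell_type s @^-1` [set k]).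
Proof. by rewrite cell_type_preimage; apply: measurable_cell. Qed.

Lemma measurable_pair_types (d1 d2 : measure_display) (T1 : measurableType d1)
    (T2 : measurableType d2) (K1 K2 : finType) (t1 : T1 -> K1) (t2 : T2 -> K2) :
  (forall k, measurable (t1 @^-1` [set k])) -> (forall k, measurable (t2 @^-1` [set k])) ->
  forall k, measurable ((fun p : T1 * T2 => (t1 p.1, t2 p.2)) @^-1` [set k]).
Proof.
move=> m1 m2 [k1 k2].
have -> : (fun p : T1 * T2 => (t1 p.1, t2 p.2)) @^-1` [set (k1, k2)] =
    (t1 @^-1` [set k1]) `*` (t2 @^-1` [set k2]).
  by apply/seteqP; split => -[x y] /= [-> ->].
exact: measurableX.
Qed.

Variables s t : seq R.
Hypothesis s01 : itv_partition 0 1 s.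
Hypothesis t01 : itv_partition 0 1 t.

Lemma measurable_fun_cells (d : measure_display) (U : measurableType d) (D : set (R * R))
    (h : nat -> nat -> U) : measurable_fun D (fun p => h (cell s p.1) (cell t p.2)).
Proof.
have -> : (fun p : R * R => h (cell s p.1) (cell t p.2)) =
    (fun k : 'I_(size s).+1 * 'I_(size t).+1 => h k.1 k.2) \o
    (fun p : R * R => (cell_type s p.1, cell_type t p.2)).
  by apply/funext => p /=; rewrite !cell_typeE.
by apply: measurable_fun_types; apply: measurable_pair_types => k; apply: measurable_cell_type.
Qed.

Lemma integral_cells (h : nat -> nat -> R) : (forall i j, 0 <= h i j) ->
  (\int[mu \x mu]_(p in Q `*` Q) (h (cell s p.1) (cell t p.2))%:E =
   (\sum_(i < size s) \sum_(j < size t) cell_area s t i j * h i j)%:E)%E.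
Proof.
move=> h0; rewrite -(@integral_iterated _ Q (fun p => (h (cell s p.1) (cell t p.2))%:E)) //; last 2 first.
- apply/measurable_EFinP; exact: (@measurable_fun_cells _ _ _ h).
- by move=> p _; rewrite lee_fin.
have inner x : (\int[mu]_(y in Q) (h (cell s x) (cell t y))%:E =
    (\sum_(j < size t) (division t j.+1 - division t j) * h (cell s x) j)%:E)%E.
  have -> : (\int[mu]_(y in Q) (h (cell s x) (cell t y))%:E =
      \int[mu]_(y in Q) (h (cell s x) (cell_type t y))%:E)%E.
    by apply: eq_integral => y _; rewrite cell_typeE.
  have := @integral_types _ _ _ mu _ _ (@measurable_cell_type t) Q
    (fun k => (h (cell s x) k)%:E).
  move=> /= ->; [|by []|by move=> k; rewrite lee_fin].
  (* The last index is the extra one, a cell of length zero. *)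
  rewrite -sumEFin big_ord_recr /= [X in (_ + X)%E](_ : _ = 0%E); last first.
    by rewrite cell_type_preimage /= (measure_cell t01) /= !division_default // subrr mule0.
  rewrite adde0; apply: eq_bigr => j _.
  by rewrite cell_type_preimage (measure_cell t01) /= -EFinM mulrC.
under eq_integral do rewrite inner.
pose g i := \sum_(j < size t) (division t j.+1 - division t j) * h i j.
have g0 i : 0 <= g i.
  apply: sumr_ge0 => j _; rewrite mulr_ge0 // subr_ge0.
  exact: division_le_mono.
have -> : (\int[mu]_(x in Q) (g (cell s x))%:E = \int[mu]_(x in Q) (g (cell_type s x))%:E)%E.
  by apply: eq_integral => x _; rewrite cell_typeE.
have := @integral_types _ _ _ mu _ _ (@measurable_cell_type s) Q (fun k => (g k)%:E).
move=> /= ->; [|by []|by move=> k; rewrite lee_fin].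
rewrite -sumEFin big_ord_recr /= [X in (_ + X)%E](_ : _ = 0%E); last first.
  by rewrite cell_type_preimage /= (measure_cell s01) /= !division_default // subrr mule0.
rewrite adde0; apply: eq_bigr => i _.
rewrite cell_type_preimage (measure_cell s01) /= -EFinM mulrC /g mulr_sumr.
by congr EFin; apply: eq_bigr => j _; rewrite mulrA.
Qed.

End CellTypes.

(** * Approximation of a graphon in L^1 by its cell suprema *)

Section Darboux.
Variables (R : realType) (W : R -> R -> R).
Notation mu := (@lebesgue_measure R).
Notation Q := (`[0, 1]%classic : set R).
Hypothesis W_graphon : graphon W.
Implicit Types s t : seq R.

Lemma graphon_itv x y : x \in `[0, 1] -> y \in `[0, 1] -> 0 <= W x y <= 1.
Proof. by case: W_graphon => _ _; apply. Qed.

Lemma cell_values_mem s t x y : itv_partition 0 1 s -> itv_partition 0 1 t ->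
  x \in `[0, 1] -> y \in `[0, 1] ->
  cell_values W s t (cell s x) (cell t y) (W x y).
Proof.
by move=> s01 t01 x01 y01; exists x; [|exists y => //]; exact: division_cell.
Qed.

Lemma cell_values_sub s t i j : itv_partition 0 1 s -> itv_partition 0 1 t ->
  cell_values W s t i j `<=` [set W x y | x in `[0, 1] & y in `[0, 1]].
Proof.
move=> s01 t01 _ [x xi [y yj <-]]; exists x; [|exists y => //].
- move: xi; rewrite /= !in_itv /= => /andP[xl xr].
  case/andP: (division_itv s01 i) => l0 _; case/andP: (division_itv s01 i.+1) => _ r1.
  by rewrite (le_trans l0 xl) (le_trans xr r1).
- move: yj; rewrite /= !in_itv /= => /andP[xl xr].
  case/andP: (division_itv t01 j) => l0 _; case/andP: (division_itv t01 j.+1) => _ r1.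
  by rewrite (le_trans l0 xl) (le_trans xr r1).
Qed.

Lemma cell_values_neq0 s t i j : itv_partition 0 1 s -> itv_partition 0 1 t ->
  cell_values W s t i j !=set0.
Proof.
move=> s01 t01; exists (W (division s i) (division t j)); exists (division s i).
  by rewrite /= in_itv /= lexx division_le_mono.
by exists (division t j) => //; rewrite /= in_itv /= lexx division_le_mono.
Qed.

Lemma graphon_values_le z : [set W x y | x in `[0, 1] & y in `[0, 1]] z -> 0 <= z <= 1.
Proof. by move=> [x x01 [y y01 <-]]; apply: graphon_itv. Qed.

Lemma cell_values_le s t i j z : itv_partition 0 1 s -> itv_partition 0 1 t ->
  cell_values W s t i j z -> 0 <= z <= 1.
Proof. by move=> s01 t01 /(cell_values_sub s01 t01) /graphon_values_le. Qed.

Section Partitions.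
Variables s t : seq R.
Hypothesis s01 : itv_partition 0 1 s.
Hypothesis t01 : itv_partition 0 1 t.

Definition cell_sup i j := sup (cell_values W s t i j).
Definition cell_inf i j := inf (cell_values W s t i j).

Lemma cell_sup_ub x y : x \in `[0, 1] -> y \in `[0, 1] ->
  W x y <= cell_sup (cell s x) (cell t y).
Proof.
move=> x01 y01; apply: ub_le_sup; last exact: cell_values_mem.
by exists 1 => z /(cell_values_le s01 t01) /andP[].
Qed.

Lemma cell_inf_lb x y : x \in `[0, 1] -> y \in `[0, 1] ->
  cell_inf (cell s x) (cell t y) <= W x y.
Proof.
move=> x01 y01; apply: ge_inf; last exact: cell_values_mem.
by exists 0 => z /(cell_values_le s01 t01) /andP[].
Qed.

Lemma cell_sup_le i j : 0 <= cell_sup i j <= sup [set W x y | x in `[0, 1] & y in `[0, 1]].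
Proof.
apply/andP; split.
  have [z Vz] := cell_values_neq0 i j s01 t01.
  have /andP[z0 _] := cell_values_le s01 t01 Vz.
  apply: le_trans z0 _; apply: ub_le_sup => //.
  by exists 1 => u /(cell_values_le s01 t01) /andP[].
apply: ge_sup; first exact: cell_values_neq0.
move=> z /(cell_values_sub s01 t01) Vz; apply: ub_le_sup => //.
by exists 1 => u /graphon_values_le /andP[].
Qed.

Lemma cell_inf_ge0 i j : 0 <= cell_inf i j.
Proof.
apply: lb_le_inf; first exact: cell_values_neq0.
by move=> z /(cell_values_le s01 t01) /andP[].
Qed.

Lemma lower_sum_le_integral :
  ((lower_sum W s t)%:E <= \int[mu \x mu]_(p in Q `*` Q) (W p.1 p.2)%:E)%E.
Proof.
rewrite -(integral_cells s01 t01 cell_inf_ge0); apply: ge0_le_integral => //.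
- exact: measurableX.
- by move=> p _; rewrite lee_fin cell_inf_ge0.
- by apply/measurable_EFinP; apply: measurable_fun_cells.
- by apply/measurable_EFinP; case: W_graphon.
- by move=> p [p1 p2]; rewrite lee_fin cell_inf_lb.
Qed.

Lemma integral_cell_sup :
  (\int[mu \x mu]_(p in Q `*` Q) (cell_sup (cell s p.1) (cell t p.2))%:E =
   (upper_sum W s t)%:E)%E.
Proof. by apply: integral_cells => // i j; case/andP: (cell_sup_le i j). Qed.

End Partitions.

Hypothesis W_riemann : riemann_integrable W.

(** Take an upper sum within [eta] of the upper integral. By Riemann integrability the latter is the
    lower integral, hence at most the Lebesgue integral of [W], so the difference integrates to at
    most [eta]. *)
Lemma darboux_approximation (eta : R) : 0 < eta ->
  exists s t, [/\ itv_partition 0 1 s, itv_partition 0 1 t &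
    (\int[mu \x mu]_(p in Q `*` Q)
       (cell_sup s t (cell s p.1) (cell t p.2) - W p.1 p.2)%:E <= eta%:E)%E].
Proof.
move=> eta0; case: W_riemann => _ low_up.
pose U := [set upper_sum W s t | s in itv_partition 0 1 & t in itv_partition 0 1].
pose L := [set lower_sum W s t | s in itv_partition 0 1 & t in itv_partition 0 1].
have p1 : itv_partition 0 1 [:: 1 : R] by apply: itv_partition1.
have mQQ : measurable (Q `*` Q) by exact: measurableX.
have [_ [s s01 [t t01 <-]] sum_lt] : exists2 u, U u & u < inf U + eta.
  apply: inf_adherent => //; split.
    by exists (upper_sum W [:: 1] [:: 1]), [:: 1] => //; exists [:: 1].
  exists 0 => _ [s s01 [t t01 <-]]; apply: sumr_ge0 => i _; apply: sumr_ge0 => j _.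
  rewrite mulr_ge0 ?mulr_ge0 ?subr_ge0 ?division_le_mono //.
  by case/andP: (cell_sup_le s01 t01 i j).
exists s, t; split=> //.
have mW : measurable_fun (Q `*` Q) (fun p => W p.1 p.2) by case: W_graphon.
have mM : measurable_fun (Q `*` Q) (fun p => cell_sup s t (cell s p.1) (cell t p.2)).
  exact: measurable_fun_cells.
set A := (\int[_]_(_ in _) _)%E.
set B := (\int[mu \x mu]_(p in Q `*` Q) (W p.1 p.2)%:E)%E.
have AB : (A + B = (upper_sum W s t)%:E)%E.
  rewrite -(integral_cell_sup s01 t01) -ge0_integralD //.
  - by apply: eq_integral => p _; rewrite -EFinD subrK.
  - by move=> p [p1' p2']; rewrite lee_fin subr_ge0 cell_sup_ub.
  - by apply/measurable_EFinP; apply: measurable_funB.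
  - by move=> p [p1' p2']; rewrite lee_fin; case/andP: (graphon_itv p1' p2').
  - exact/measurable_EFinP.
have A0 : (0 <= A)%E.
  by apply: integral_ge0 => p [p1' p2']; rewrite lee_fin subr_ge0 cell_sup_ub.
have B0 : (0 <= B)%E.
  by apply: integral_ge0 => p [p1' p2']; rewrite lee_fin; case/andP: (graphon_itv p1' p2').
(* Both integrals are finite because they are nonnegative with a finite sum; this permits
   subtraction in the reals. *)
have [a Aa] : exists a, A = a%:E.
  move: AB A0 B0; case: A => [a _ _ _|//|//]; first by exists a.
  by case: B.
have [b Bb] : exists b, B = b%:E.
  move: AB B0; rewrite Aa; case: B => [b _ _|//|//].
  by exists b.
have Lb : lower_integral W <= b.
  apply: ge_sup; first by exists (lower_sum W [:: 1] [:: 1]), [:: 1] => //; exists [:: 1].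
  move=> _ [s' s01' [t' t01' <-]].
  by rewrite -lee_fin -Bb lower_sum_le_integral.
move: AB; rewrite Aa Bb -EFinD => -[AB]; rewrite lee_fin.
move: low_up Lb sum_lt; rewrite /upper_integral -/U => -> Lb sum_lt.
by rewrite -AB in sum_lt; lra.
Qed.

End Darboux.

(** * Finitely many types whose costs dominate the logarithm of 1/(1 - W) *)

Section TypeApproximation.
Variables (R : realType) (W : R -> R -> R).
Notation mu := (@lebesgue_measure R).
Notation Q := (`[0, 1]%classic : set R).
Let m : R := sup [set W x y | x in `[0, 1] & y in `[0, 1]].
Hypothesis W_graphon : graphon W.
Hypothesis W_lt1 : m < 1.

Lemma graphon_le_sup x y : x \in `[0, 1] -> y \in `[0, 1] -> 0 <= W x y <= m.
Proof.
move=> x01 y01; case/andP: (graphon_itv W_graphon x01 y01) => -> _ /=.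
apply: ub_le_sup; last by exists x => //; exists y.
by exists 1 => u /(graphon_values_le W_graphon) /andP[].
Qed.

Let m_ge0 : 0 <= m.
Proof.
have x01 : (0 : R) \in `[0, 1] by rewrite in_itv /= lexx ler01.
by case/andP: (graphon_le_sup x01 x01) => W0; apply: le_trans.
Qed.

Let W1_gt0 x y : x \in `[0, 1] -> y \in `[0, 1] -> 0 < 1 - W x y.
Proof.
move=> x01 y01; case/andP: (graphon_le_sup x01 y01) => _ Wm.
by have := W_lt1; lra.
Qed.

Section Supremum.
Variables (S : set R).
Hypothesis mS : measurable S.
Hypothesis SQ : S `<=` Q.

Lemma integral_log_eq :
  (\int[mu]_(x in S) \int[mu]_(y in S) (ln (1 / (1 - W x y)))%:E =
   \int[mu \x mu]_(p in S `*` S) (- ln (1 - W p.1 p.2))%:E)%E.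
Proof.
rewrite -(@integral_iterated _ S (fun p => (- ln (1 - W p.1 p.2))%:E)) //; last 2 first.
- apply/measurable_EFinP; apply: measurableT_comp => //.
  apply: (measurableT_comp (@measurable_ln R)).
  apply: measurable_funB => //; case: W_graphon => mW _ _.
  apply: measurable_funS mW; first exact: measurableX.
  by move=> p [/= p1 p2]; split => /=; exact: SQ.
- move=> p [/= /SQ p1 /SQ p2]; rewrite lee_fin oppr_ge0 ln_le0 //.
  by case/andP: (graphon_le_sup p1 p2) => ? _; lra.
apply: eq_integral => x /set_mem xS; apply: eq_integral => y /set_mem yS /=.
by rewrite div1r lnV // posrE W1_gt0 //; exact: SQ.
Qed.

Lemma integral_log_le (ph : R) : phi W = ph%:E -> (0 < mu S)%E ->
  (\int[mu \x mu]_(p in S `*` S) (- ln (1 - W p.1 p.2))%:E <= ph%:E * mu S)%E.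
Proof.
move=> phE S0; rewrite -integral_log_eq.
have Sfin : mu S \is a fin_num.
  rewrite ge0_fin_numE //; apply: (@le_lt_trans _ _ (mu Q)).
    by apply: le_measure => //; rewrite inE.
  by rewrite lebesgue_measure_itv /= lte_fin ltr01 -EFinB ltry.
have : (((fine (mu S))^-1)%:E * \int[mu]_(x in S)
    \int[mu]_(y in S) (ln (1 / (1 - W x y)))%:E <= ph%:E)%E.
  by rewrite -phE; apply: ereal_sup_ubound; exists S.
have fS0 : 0 < fine (mu S) by rewrite -lte_fin fineK.
by rewrite lee_pdivrMl // fineK // muleC.
Qed.

End Supremum.

Lemma phi_ge0 : (0 <= phi W)%E.
Proof.
have mQ : measurable Q by [].
apply: (@le_trans _ _ (((fine (mu Q))^-1)%:E * \int[mu]_(x in Q)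
    \int[mu]_(y in Q) (ln (1 / (1 - W x y)))%:E)%E).
  rewrite mule_ge0 ?lee_fin ?invr_ge0 ?fine_ge0 //.
  rewrite integral_log_eq //; apply: integral_ge0 => p [/= p1 p2].
  rewrite lee_fin oppr_ge0 ln_le0 //.
  by case/andP: (graphon_le_sup p1 p2) => ? _; lra.
apply: ereal_sup_ubound; exists Q => //; split=> //.
by rewrite lebesgue_measure_itv /= lte_fin ltr01 -EFinB lte_fin subr0.
Qed.

Section Step.
Variables s t : seq R.
Hypothesis s01 : itv_partition 0 1 s.
Hypothesis t01 : itv_partition 0 1 t.

(** A vertex may be the first or the second argument of [W], and the two partitions may differ, so
    its type records its cell in both. *)
Definition types : finType := ('I_(size s).+1 * 'I_(size t).+1)%type.

Definition type_of (x : R) : types := (cell_type s x, cell_type t x).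

Definition log_sup (i j : nat) : R := - ln (1 - cell_sup W s t i j).

(** Cell suprema need not be symmetric although [W] is, since [s] and [t] may differ. Both orders
    dominate the logarithmic cost of a pair, hence so does their mean. *)
Definition type_cost (k j : types) : R := (log_sup k.1 j.2 + log_sup j.1 k.2) / 2.

Definition type_weight (k : types) : R := fine (mu (Q `&` type_of @^-1` [set k])).

Lemma log_sup_itv i j : 0 <= log_sup i j <= - ln (1 - m).
Proof.
have /andP[M0 Mm] := cell_sup_le W_graphon s01 t01 i j; have m1 := W_lt1.
rewrite /log_sup oppr_ge0 lerN2 ln_le0 /=; last by lra.
by rewrite ler_ln ?posrE; rewrite /m in m1 *; lra.
Qed.

Lemma type_cost_sym k j : type_cost k j = type_cost j k.
Proof. by rewrite /type_cost addrC. Qed.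

Lemma type_cost_itv k j : 0 <= type_cost k j <= - ln (1 - m).
Proof.
have /andP[a0 a1] := log_sup_itv k.1 j.2; have /andP[b0 b1] := log_sup_itv j.1 k.2.
by rewrite /type_cost; apply/andP; split; lra.
Qed.

Lemma log_le_log_sup x y : x \in `[0, 1] -> y \in `[0, 1] ->
  - ln (1 - W x y) <= log_sup (cell s x) (cell t y).
Proof.
move=> x01 y01; have WM := cell_sup_ub W_graphon s01 t01 x01 y01.
have /andP[M0 Mm] := cell_sup_le W_graphon s01 t01 (cell s x) (cell t y).
have W1 := W1_gt0 x01 y01; have m1 := W_lt1; rewrite /m in m1.
by rewrite /log_sup lerN2 ler_ln ?posrE; lra.
Qed.

(** With q = (1 - W)/(1 - M), the difference of the logarithms is ln q <= q - 1 = (M - W)/(1 - M),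
    and M <= m. *)
Lemma log_sup_le_log x y : x \in `[0, 1] -> y \in `[0, 1] ->
  log_sup (cell s x) (cell t y) <= - ln (1 - W x y) +
    (1 - m)^-1 * (cell_sup W s t (cell s x) (cell t y) - W x y).
Proof.
move=> x01 y01; rewrite /log_sup; set M := cell_sup _ _ _ _ _.
have WM : W x y <= M := cell_sup_ub W_graphon s01 t01 x01 y01.
have /andP[M0 Mm] : 0 <= M <= m := cell_sup_le W_graphon s01 t01 (cell s x) (cell t y).
have W1 := W1_gt0 x01 y01; have m1 := W_lt1.
have M1 : 0 < 1 - M by lra.
have mm : 0 < 1 - m by lra.
have -> : - ln (1 - M) = - ln (1 - W x y) + ln ((1 - W x y) / (1 - M)).
  by rewrite ln_div ?posrE //; ring.
rewrite lerD2l; apply: le_trans (_ : (1 - W x y) / (1 - M) - 1 <= _).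
  have q0 : 0 < (1 - W x y) / (1 - M) by rewrite divr_gt0.
  by have := le_ln1Dx (x := (1 - W x y) / (1 - M) - 1); rewrite subrKC; apply; lra.
have -> : (1 - W x y) / (1 - M) - 1 = (1 - M)^-1 * (M - W x y).
  by field; rewrite gt_eqF.
by rewrite ler_wpM2r ?subr_ge0 // lef_pV2 ?posrE //; lra.
Qed.

Lemma expR_type_cost x y : x \in `[0, 1] -> y \in `[0, 1] ->
  expR (- type_cost (type_of x) (type_of y)) <= 1 - W x y.
Proof.
move=> x01 y01; rewrite -[leRHS]lnK ?posrE ?W1_gt0 // ler_expR /type_cost /=.
have h1 := log_le_log_sup x01 y01; have h2 := log_le_log_sup y01 x01.
have Wsym : W y x = W x y by case: W_graphon => _ + _; apply.
rewrite Wsym in h2; rewrite !cell_typeE; lra.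
Qed.

Lemma measurable_type_of k : measurable (type_of @^-1` [set k]).
Proof.
case: k => k1 k2.
have -> : type_of @^-1` [set (k1, k2)] =
    cell_type s @^-1` [set k1] `&` cell_type t @^-1` [set k2].
  by apply/seteqP; split => x; rewrite /type_of /= => -[-> ->].
by apply: measurableI; apply: measurable_cell_type.
Qed.

Lemma mu_type k : mu (Q `&` type_of @^-1` [set k]) = (type_weight k)%:E.
Proof.
rewrite fineK // ge0_fin_numE //; apply: (@le_lt_trans _ _ (mu Q)).
  apply: le_measure; rewrite ?inE //.
    by apply: measurableI => //; apply: measurable_type_of.
by rewrite lebesgue_measure_itv /= lte_fin ltr01 -EFinB ltry.
Qed.

Lemma type_weight_ge0 k : 0 <= type_weight k.
Proof. exact: fine_ge0. Qed.

Section Block.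
Variable B : {set types}.
Let S : set R := Q `&` type_of @^-1` [set k | k \in B].

Let mS : measurable S.
Proof.
by apply: measurableI => //; apply: measurable_preimage_types; apply: measurable_type_of.
Qed.

Lemma integral_block (h : types -> \bar R) : (forall k, 0 <= h k)%E ->
  (\int[mu]_(x in S) h (type_of x) = \sum_(k in B) h k * (type_weight k)%:E)%E.
Proof.
move=> h0; have := @integral_types _ _ _ mu _ _ measurable_type_of S h mS h0.
move=> /= ->; rewrite [RHS]big_mkcond; apply: eq_bigr => k _.
have -> : S `&` type_of @^-1` [set k] =
    if k \in B then Q `&` type_of @^-1` [set k] else set0.
  apply/seteqP; split=> x; rewrite /S /=.
    by move=> [[xQ xB] xk]; rewrite xk in xB; rewrite xB.
  by case: ifP => // kB [xQ xk]; rewrite xk.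
by case: (k \in B); rewrite ?mu_type // measure0 mule0.
Qed.

Lemma mu_block : mu S = (\sum_(k in B) type_weight k)%:E.
Proof.
have := integral_block (fun _ => lee01); rewrite integral_cst // mul1e => ->.
by rewrite -sumEFin; apply: eq_bigr => k _; rewrite mul1e.
Qed.

(** Over a square block the two halves of [type_cost] have the same sum, by exchanging k and j, so
    symmetrising does not alter the integral. *)
Lemma integral_block2 :
  (\int[mu \x mu]_(p in S `*` S) (log_sup (cell s p.1) (cell t p.2))%:E =
   (\sum_(k in B) \sum_(j in B) type_cost k j * type_weight k * type_weight j)%:E)%E.
Proof.
have l0 i j : 0 <= log_sup i j by case/andP: (log_sup_itv i j).
rewrite -(@integral_iterated _ S (fun p => (log_sup (cell s p.1) (cell t p.2))%:E)) //; last 2 first.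
- by apply/measurable_EFinP; apply: measurable_fun_cells.
- by move=> p _; rewrite lee_fin.
have inner (k : types) : (\int[mu]_(y in S) (log_sup k.1 (cell t y))%:E =
    (\sum_(j in B) log_sup k.1 j.2 * type_weight j)%:E)%E.
  have := @integral_block (fun j => (log_sup k.1 j.2)%:E) (fun j => _).
  rewrite /= => H; rewrite -sumEFin -H => [|j]; last by rewrite lee_fin.
  by apply: eq_integral => y _; rewrite cell_typeE.
have -> : (\int[mu]_(x in S) \int[mu]_(y in S) (log_sup (cell s x) (cell t y))%:E =
    \int[mu]_(x in S) (\sum_(j in B) log_sup (type_of x).1 j.2 * type_weight j)%:E)%E.
  by apply: eq_integral => x _; rewrite -inner /= cell_typeE.
have := @integral_block (fun k => (\sum_(j in B) log_sup k.1 j.2 * type_weight j)%:E) (fun k => _).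
rewrite /= => -> => [|k]; last first.
  by rewrite lee_fin; apply: sumr_ge0 => j _; rewrite mulr_ge0 ?type_weight_ge0.
rewrite sumEFin; congr EFin.
have -> : \sum_(k in B) \sum_(j in B) type_cost k j * type_weight k * type_weight j =
   2^-1 * \sum_(k in B) \sum_(j in B) log_sup k.1 j.2 * type_weight k * type_weight j +
   2^-1 * \sum_(k in B) \sum_(j in B) log_sup j.1 k.2 * type_weight k * type_weight j.
  rewrite !mulr_sumr -big_split; apply: eq_bigr => k _ /=.
  rewrite !mulr_sumr -big_split; apply: eq_bigr => j _ /=.
  by rewrite /type_cost; ring.
rewrite [X in _ + 2^-1 * X]exchange_big /=.
have -> : \sum_(j in B) \sum_(k in B) log_sup j.1 k.2 * type_weight k * type_weight j =
  \sum_(k in B) \sum_(j in B) log_sup k.1 j.2 * type_weight k * type_weight j.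
  by apply: eq_bigr => k _; apply: eq_bigr => j _; rewrite mulrAC.
rewrite -mulrDl [2^-1 + 2^-1](_ : _ = 1) ?mul1r; last by field.
apply: eq_bigr => k _; rewrite mulr_suml; apply: eq_bigr => j _.
by rewrite mulrAC.
Qed.

End Block.
End Step.

Hypothesis W_riemann : riemann_integrable W.

Lemma block_form_le (ph ep : R) : phi W = ph%:E -> 0 < ep ->
  exists s t, [/\ itv_partition 0 1 s, itv_partition 0 1 t &
    forall B : {set types s t},
    \sum_(k in B) \sum_(j in B) type_cost k j * type_weight k * type_weight j <=
    (ph + ep) * \sum_(k in B) type_weight k].
Proof.
move=> phE ep0; have m1 := W_lt1; have m0 := m_ge0.
have ph0 : 0 <= ph by rewrite -lee_fin -phE phi_ge0.
(* An upper bound for the costs; the added 1 keeps it positive when [W] vanishes. *)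
pose C := 1 - ln (1 - m).
have ln0 : ln (1 - m) <= 0 by apply: ln_le0; lra.
have C1 : 1 <= C by rewrite /C; lra.
have C0 : 0 < C by apply: lt_le_trans C1.
(* Threshold between small and large blocks: for mass S <= d1 the trivial bound C S^2 is at most ep
   S. *)
pose d1 := ep / C.
have d10 : 0 < d1 by rewrite divr_gt0.
have m10 : 0 < 1 - m by lra.
(* The factor 1 - m cancels the Lipschitz constant of -ln(1 - u) on [0, m]; the remaining error ep
   d1 is below ep S on large blocks. *)
have [|s [t [s01 t01 st]]] := darboux_approximation W_graphon W_riemann (eta := ep * d1 * (1 - m)).
  by apply: mulr_gt0 => //; apply: mulr_gt0.
exists s, t; split=> // B.
set S : R := \sum_(k in B) type_weight k.
have p0 k : 0 <= @type_weight s t k by exact: type_weight_ge0.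
have S0 : 0 <= S by apply: sumr_ge0 => k _.
have [Sd|dS] := leP S d1.
  apply: (@le_trans _ _ (C * S * S)).
    rewrite -mulrA mulr_suml mulr_sumr; apply: ler_sum => k _.
    rewrite mulr_sumr mulr_sumr; apply: ler_sum => j _.
    rewrite -mulrA ler_wpM2r ?mulr_ge0 //.
    by case/andP: (type_cost_itv s01 t01 k j) => _ /le_trans; apply; rewrite /C; lra.
  rewrite ler_wpM2r //; apply: (@le_trans _ _ ep); last by lra.
  by rewrite mulrC -ler_pdivlMr.
pose D : set R := Q `&` (@type_of s t) @^-1` [set k | k \in B].
have mD : measurable D.
  by apply: measurableI => //; apply: measurable_preimage_types; apply: measurable_type_of.
have DQ : D `<=` Q by move=> x [].
have muD : mu D = S%:E by exact: mu_block.
have mDD : measurable (D `*` D) by exact: measurableX.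
have mQQ : measurable (Q `*` Q) by exact: measurableX.
have DDQQ : D `*` D `<=` Q `*` Q by move=> p [/= p1 p2]; split; apply: DQ.
have mW : measurable_fun (Q `*` Q) (fun p => W p.1 p.2) by case: W_graphon.
have mlog : measurable_fun (D `*` D) (fun p => - ln (1 - W p.1 p.2)).
  apply: measurableT_comp => //; apply: (measurableT_comp (@measurable_ln R)).
  by apply: measurable_funB => //; apply: measurable_funS mW.
have mdiff : measurable_fun (Q `*` Q)
    (fun p => cell_sup W s t (cell s p.1) (cell t p.2) - W p.1 p.2).
  by apply: measurable_funB => //; apply: measurable_fun_cells.
have diff0 p : (Q `*` Q) p -> 0 <= cell_sup W s t (cell s p.1) (cell t p.2) - W p.1 p.2.
  by move=> [p1 p2]; rewrite subr_ge0; apply: cell_sup_ub.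
have log0 p : (D `*` D) p -> 0 <= - ln (1 - W p.1 p.2).
  move=> /DDQQ [p1 p2]; rewrite oppr_ge0 ln_le0 //.
  by case/andP: (graphon_le_sup p1 p2) => ? _; lra.
pose e1 p := ((1 - m)^-1%:E * (cell_sup W s t (cell s p.1) (cell t p.2) - W p.1 p.2)%:E)%E.
have e1_ge0 p : (Q `*` Q) p -> (0 <= e1 p)%E.
  by move=> Qp; rewrite mule_ge0 ?lee_fin ?invr_ge0 ?(ltW m10) // diff0.
have me1 : measurable_fun (Q `*` Q) e1.
  by apply: emeasurable_funM => //; apply/measurable_EFinP.
have int_e1 : (\int[mu \x mu]_(p in Q `*` Q) e1 p <= (ep * d1)%:E)%E.
  rewrite ge0_integralZl ?lee_fin ?invr_ge0 ?(ltW m10) //; last exact/measurable_EFinP.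
  apply: le_trans (lee_wpmul2l _ st) _; first by rewrite lee_fin invr_ge0 ltW.
  rewrite -EFinM lee_fin le_eqVlt; apply/orP; left; apply/eqP; field.
  by rewrite gt_eqF.
have main : ((\sum_(k in B) \sum_(j in B) type_cost k j * type_weight k * type_weight j)%:E
    <= (ph * S + ep * d1)%:E)%E.
  rewrite -(integral_block2 s01 t01 B) -/D.
  apply: (@le_trans _ _ (\int[mu \x mu]_(p in D `*` D)
      ((- ln (1 - W p.1 p.2))%:E + e1 p))%E).
    apply: ge0_le_integral => //.
    - by move=> p _; rewrite lee_fin; case/andP: (log_sup_itv s01 t01 (cell s p.1) (cell t p.2)).
    - by apply/measurable_EFinP; apply: measurable_fun_cells.
    - apply: emeasurable_funD; first exact/measurable_EFinP.
      exact: measurable_funS me1.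
    - by move=> p /DDQQ [p1 p2]; rewrite /e1 -EFinM -EFinD lee_fin; apply: log_sup_le_log.
  have me1D : measurable_fun (D `*` D) e1 by apply: measurable_funS me1.
  rewrite ge0_integralD //; first last.
  - by move=> p /DDQQ; apply: e1_ge0.
  - exact/measurable_EFinP.
  rewrite EFinD EFinM -muD; apply: leeD.
    apply: integral_log_le => //; rewrite muD lte_fin.
    exact: lt_trans dS.
  apply: le_trans int_e1; apply: ge0_subset_integral => //.
rewrite lee_fin in main; apply: le_trans main _.
by rewrite mulrDl lerD2l ler_wpM2l // ltW.
Qed.

Lemma type_approximation (ph ep : R) : phi W = ph%:E -> 0 < ep ->
  exists (K : finType) (tau : R -> K) (c : K -> K -> R) (p : K -> R) (C p0 : R),
  [/\ forall k, measurable (tau @^-1` [set k]),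
      forall j k, c j k = c k j,
      forall j k, 0 <= c j k <= C &
  [/\ forall x y, x \in `[0, 1] -> y \in `[0, 1] ->
        expR (- c (tau x) (tau y)) <= 1 - W x y,
      forall k, mu (Q `&` tau @^-1` [set k]) = (p k)%:E,
      0 < p0 &
      forall y : K -> R, (forall k, 0 <= y k <= p k + p0) ->
      \sum_k \sum_j c k j * y k * y j <= (ph + ep) * \sum_k y k]].
Proof.
move=> phE ep0; have m1 := W_lt1; have m0 := m_ge0.
have [|s [t [s01 t01 HB]]] := @block_form_le ph (ep / 2) phE; first by rewrite divr_gt0.
have ph0 : 0 <= ph by rewrite -lee_fin -phE phi_ge0.
pose K := types s t; pose C := 1 - ln (1 - m).
have C0 : 0 < C.
  have : ln (1 - m) <= 0 by apply: ln_le0; lra.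
  by rewrite /C; lra.
(* Chosen so that 2 C p0 (|K| + 1) = ep/2, the half of [ep] not spent on [block_form_le]. *)
pose p0 := ep / (4 * C * #|K|.+1%:R).
have N0 : 0 < #|K|.+1%:R :> R by rewrite ltr0n.
have p00 : 0 < p0 by rewrite divr_gt0 // !mulr_gt0.
have cC (j k : K) : 0 <= type_cost j k <= C.
  by case/andP: (type_cost_itv s01 t01 j k) => -> /le_trans; apply; rewrite /C; lra.
exists K, (@type_of s t), (@type_cost s t), (@type_weight s t), C, p0; split=> //.
- exact: measurable_type_of.
- exact: type_cost_sym.
split=> //; [by move=> x y; apply: expR_type_cost|exact: mu_type|].
have c0 (j k : K) : 0 <= type_cost j k by case/andP: (cC j k).
have cle (j k : K) : type_cost j k <= C by case/andP: (cC j k).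
have w0 (k : K) : 0 <= type_weight k by exact: type_weight_ge0.
apply: (quadratic_box_enlarged c0 w0 cle (ltW p00) (Phi := ph + ep / 2)).
- by rewrite addr_ge0 // divr_ge0 // ltW.
- have -> : ph + ep - (ph + ep / 2) = ep / 2 by field.
  have -> : ep / 2 = 2 * C * p0 * #|K|.+1%:R by rewrite /p0; field; rewrite !gt_eqF.
  have Cp0 : 0 <= 2 * C * p0 by rewrite (mulr_ge0 (mulr_ge0 (ler0n _ 2) (ltW C0)) (ltW p00)).
  by apply: ler_wpM2l => //; rewrite ler_nat.
exact: quadratic_box.
Qed.

End TypeApproximation.

(** * The random graph *)

Section FiniteMeasure.
Variables (d : measure_display) (T : measurableType d) (R : realType).
Variables (mu : {measure set T -> \bar R}) (K : finType).

Lemma measure_types (tau : T -> K) (E : set T) (D : pred K) : measurable E ->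
  (forall k, measurable (tau @^-1` [set k])) ->
  (mu (E `&` [set x | D (tau x)]) = \sum_(k | D k) mu (E `&` tau @^-1` [set k]))%E.
Proof.
move=> mE mtau; have mD : measurable [set x | D (tau x)].
  exact: (measurable_preimage_types mtau [set k | D k]).
rewrite setIC -integral_indic //.
have := @integral_types _ _ _ mu _ _ mtau E (fun k => (D k)%:R%:E) mE.
move=> /= H; rewrite [RHS]big_mkcond; transitivity (\int[mu]_(x in E) (D (tau x))%:R%:E)%E.
  by apply: eq_integral => x _; rewrite indicE mem_setE.
rewrite H => [|k]; last by rewrite lee_fin.
by apply: eq_bigr => k _; case: (D k); rewrite ?mul1e ?mul0e.
Qed.

Lemma measure_union_le (A : set T) (F : K -> set T) : measurable A ->
  (forall k, measurable (F k)) -> A `<=` \bigcup_k F k ->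
  (mu A <= \sum_k mu (F k))%E.
Proof.
move=> mA mF AF; rewrite -[A]setIT -integral_indic //.
have -> : (\sum_k mu (F k) = \int[mu]_(x in setT) \sum_k (\1_(F k) x)%:E)%E.
  rewrite ge0_integral_sum //; last by move=> k; apply/measurable_EFinP.
  by apply: eq_bigr => k _; rewrite integral_indic // setIT.
apply: ge0_le_integral => //.
- exact/measurable_EFinP.
- by apply: emeasurable_sum => k; apply/measurable_EFinP.
move=> x _; rewrite indicE; have [/set_mem Ax|_] := boolP (x \in A); last first.
  by apply: sume_ge0 => k _; rewrite lee_fin.
have [k _ Fk] := AF _ Ax; rewrite (bigD1 k) //= indicE mem_set // leeDl //.
by apply: sume_ge0 => j _; rewrite lee_fin.
Qed.

End FiniteMeasure.

Lemma uniform_probE (R : realType) (A : set R) : measurable A ->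
  uniform_prob (@ltr01 R) A = lebesgue_measure (`[0, 1] `&` A).
Proof.
move=> mA; rewrite /uniform_prob integral_uniform_pdf.
rewrite (eq_integral (fun=> 1%:E)); last first.
  move=> x; rewrite inE => -[_]; rewrite /= in_itv /= /uniform_pdf => ->.
  by rewrite subr0 invr1.
by rewrite integral_cst /= ?mul1e 1?setIC //; apply: measurableI.
Qed.

(** * Concentration of the type counts *)

Section Tail.
Variables (R : realType) (n : nat).

Lemma lipschitz1_count (a : R) :
  lipschitz1 (fun e : {ffun 'I_n -> bool} => a - \sum_i (e i)%:R).
Proof.
move=> e i b; rewrite opprD addrACA subrr add0r opprK.
rewrite (bigD1 i) //= [X in _ + X](bigD1 i) //= ffunE eqxx.
rewrite [X in - (_ + X) + _](eq_bigr (fun j => (e j)%:R)); last first.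
  by move=> j /negPf ji; rewrite ffunE ji.
rewrite opprD addrACA addNr addr0 ler_norml.
by case: b; case: (e i) => /=; apply/andP; split; lra.
Qed.

(** The lower-tail bound is reused for (p + p0) n minus the count, of mean p0 n. With l <= p0/2 the
    quadratic term l^2 n takes at most half of l p0 n. *)
Lemma expect_count_tail (p p0 : R) : 0 <= p <= 1 -> 0 < p0 ->
  expect (fun=> p) (fun e : {ffun 'I_n -> bool} =>
     ((p + p0) * n%:R < \sum_i (e i)%:R)%R%:R) <=
  expR (- (Num.min 1 (p0 / 2) * (p0 / 2) * n%:R)).
Proof.
move=> p01 p00; set l := Num.min 1 _.
have l0 : 0 <= l by rewrite le_min ler01 divr_ge0 // ltW.
have l1 : l <= 1 by rewrite ge_min lexx.
have lp : l <= p0 / 2 by rewrite ge_min lexx orbT.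
pose f (e : {ffun 'I_n -> bool}) := (p + p0) * n%:R - \sum_i (e i)%:R.
have l01 : 0 <= l <= 1 by rewrite l0.
have := @expect_lower_tail R _ (fun=> p) (fun=> p01) f (p0 * n%:R) l
  (fun e => (p + p0) * n%:R < \sum_i (e i)%:R) l01 (lipschitz1_count _).
move=> /(_ _ _) /le_trans; apply.
- have -> : expect (fun=> p) f = p0 * n%:R; last by [].
  rewrite /f /expect averagesD averages_cst.
  rewrite (@averages_eq _ _ _ _ _ (fun e : {ffun 'I_n -> bool} => -1 * \sum_i (e i)%:R)); last first.
    by move=> e; rewrite mulN1r.
  rewrite averagesZ averages_sum (eq_bigr (fun=> p)) => [|i _]; last exact: expect_coord.
  by rewrite sumr_const card_ord -[_ *+ _]mulr_natr; ring.
- by move=> e lt; rewrite /f subr_le0 ltW.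
rewrite ler_expR card_ord.
have : l * l * n%:R <= l * (p0 / 2) * n%:R by rewrite ler_wpM2r // ler_wpM2l.
by rewrite expr2; lra.
Qed.

End Tail.

Lemma expect_sum_atoms (R : realType) (I : finType) (w : I -> R) (D : pred {ffun I -> bool}) :
  expect w (fun e => (D e)%:R) =
  \sum_(b | D b) \prod_i (if b i then w i else 1 - w i).
Proof.
transitivity (expect w (fun e => \sum_(b | D b) \prod_i ((e i == b i)%:R : R))).
  apply: expect_eq => e; rewrite big_mkcond (bigD1 e) //= [X in _ + X]big1 => [|b be].
    by rewrite big1 ?addr0 => [|i _]; [case: (D e)|rewrite eqxx].
  case: (D b) => //; have /fintype.existsP[i ei] : [exists i, e i != b i].
    rewrite -negb_forall; apply: contra be => /fintype.forallP eb.
    by apply/eqP/ffunP => i; rewrite (eqP (eb i)).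
  by rewrite (bigD1 i) //= (negPf ei) mul0r.
rewrite /expect averages_sum; apply: eq_bigr => b _; rewrite -/(expect _ _).
rewrite (expect_prod w (fun i c => (c == b i)%:R)); apply: eq_bigr => i _.
by case: (b i); rewrite !(mulr0, mulr1) ?addr0 ?add0r.
Qed.

Section Sampling.
Variables (d : measure_display) (T : measurableType d) (R : realType).
Variables (P : probability T R) (W : R -> R -> R) (n : nat).
Variables (X : 'I_n -> {RV P >-> R}) (G : T -> sgraph n).
Hypothesis G_law : is_random_graph W X G.
Hypothesis W_graphon : graphon W.

Lemma probability_X_in (A : set R) (p : R) i : measurable A ->
  lebesgue_measure (`[0, 1] `&` A) = p%:E -> P (X i @^-1` A) = p%:E.
Proof.
by move=> mA Ap; have := rg_uniform G_law i mA; rewrite uniform_probE // Ap.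
Qed.

Lemma measurable_X_in (A : set R) i : measurable A -> measurable (X i @^-1` A).
Proof. by move=> mA; rewrite -[X in measurable X]setTI; apply: measurable_funP. Qed.

(** Independence, applied to [A] or its complement in each coordinate, makes the membership pattern
    a vector of independent Bernoulli variables, so its law can be computed with [expect]. *)
Lemma probability_pattern (A : set R) (p : R) (D : pred {ffun 'I_n -> bool}) :
  measurable A -> lebesgue_measure (`[0, 1] `&` A) = p%:E ->
  P [set w | D [ffun i => `[< A (X i w) >]]] =
  (expect (fun=> p) (fun e => (D e)%:R))%:E.
Proof.
move=> mA Ap; pose pat w : {ffun 'I_n -> bool} := [ffun i => `[< A (X i w) >]].
pose side (b : bool) := if b then A else ~` A.
have mside b : measurable (side b) by case: b => //; apply: measurableC.
have patE b : pat @^-1` [set b] = \bigcap_(i in [set: 'I_n]) (X i @^-1` side (b i)).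
  apply/seteqP; split => w /=.
    by move=> <- i _ /=; rewrite ffunE /side; case: asboolP.
  move=> H; apply/ffunP => i; rewrite ffunE; have := H i I; rewrite /side /=.
  by case: (b i) => Xi; apply/asboolP.
have mpat b : measurable (pat @^-1` [set b]).
  by rewrite patE; apply: fin_bigcap_measurable => // i _; apply: measurable_X_in.
have := measure_types P D measurableT mpat; rewrite setTI => ->.
rewrite expect_sum_atoms -sumEFin; apply: eq_bigr => b _.
rewrite setTI patE; have := rg_independent G_law (fun i => mside (b i)).
move=> /= ->.
rewrite (eq_bigr (fun i => (if b i then p else 1 - p)%:E)); first by rewrite prodEFin.
move=> i _; rewrite /side; case: (b i); first exact: probability_X_in.
by rewrite preimage_setC probability_setC ?(probability_X_in _ mA Ap) //; apply: measurable_X_in.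
Qed.

Variables (K : finType) (tau : R -> K) (p : K -> R) (p0 : R).
Hypothesis mtau : forall k, measurable (tau @^-1` [set k]).
Hypothesis tau_p : forall k,
  lebesgue_measure (`[0, 1] `&` tau @^-1` [set k]) = (p k)%:E.
Hypothesis p0_gt0 : 0 < p0.

Definition type_count (x : n.-tuple R) k : R := \sum_(i < n) (tau (tnth x i) == k)%:R.

Lemma probability_type_count k :
  (P [set w | ((p k + p0) * n%:R < type_count (sample X w) k)%R] <=
   (expR (- (Num.min 1 (p0 / 2) * (p0 / 2) * n%:R)))%:E)%E.
Proof.
have p01 : 0 <= p k <= 1.
  rewrite -!lee_fin -tau_p measure_ge0 /=.
  have mQ : measurable (`[0, 1]%classic : set R) by [].
  apply: (@le_trans _ _ (lebesgue_measure (`[0, 1]%classic : set R))).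
    by apply: le_measure; rewrite ?inE //; apply: measurableI => //; apply: mtau.
  by rewrite lebesgue_measure_itv /= lte_fin ltr01 -EFinB lee_fin subr0.
have := probability_pattern (fun e => (p k + p0) * n%:R < \sum_i (e i)%:R) (mtau k) (tau_p k).
have E w : \sum_i ([ffun i => `[< (tau @^-1` [set k]) (X i w) >]] i)%:R =
    type_count (sample X w) k.
  apply: eq_bigr => i _; rewrite ffunE tnth_mktuple; congr (nat_of_bool _)%:R.
  by apply/asboolP/eqP.
have -> : [set w | (p k + p0) * n%:R <
    \sum_i ([ffun i => `[< (tau @^-1` [set k]) (X i w) >]] i)%:R] =
    [set w | (p k + p0) * n%:R < type_count (sample X w) k].
  by apply: eq_set => w; rewrite E.
by move=> ->; rewrite lee_fin expect_count_tail.
Qed.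

(** Only upper bounds are asked: a shortage of vertices of some type never hinders the greedy
    colouring. *)
Definition typical : set (n.-tuple R) :=
  [set x | forall k, type_count x k <= (p k + p0) * n%:R].

Lemma measurable_tuple_types (D : set {ffun 'I_n -> K}) :
  measurable [set x : n.-tuple R | D [ffun i => tau (tnth x i)]].
Proof.
pose z (x : n.-tuple R) : {ffun 'I_n -> K} := [ffun i => tau (tnth x i)].
have mz b : measurable (z @^-1` [set b]).
  have -> : z @^-1` [set b] = \bigcap_(i in [set: 'I_n]) ((@tnth n R)^~ i @^-1` (tau @^-1` [set b i])).
    apply/seteqP; split => x /=; first by move=> <- i _ /=; rewrite ffunE.
    by move=> H; apply/ffunP => i; rewrite ffunE; apply: (H i I).
  apply: fin_bigcap_measurable => // i _; rewrite -[X in measurable X]setTI.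
  exact: measurable_tnth.
exact: (measurable_preimage_types mz).
Qed.

Let type_countE x k :
  \sum_(i < n) ([ffun i => tau (tnth x i)] i == k)%:R = type_count x k.
Proof. by apply: eq_bigr => i _; rewrite ffunE. Qed.

Lemma measurable_typical : measurable typical.
Proof.
have := measurable_tuple_types [set b | forall k, \sum_i (b i == k)%:R <= (p k + p0) * n%:R].
congr measurable; apply/seteqP; split => x /= H k; have := H k; by rewrite type_countE.
Qed.

Lemma measurable_atypical k :
  measurable [set x : n.-tuple R | (p k + p0) * n%:R < type_count x k].
Proof.
have := measurable_tuple_types [set b | (p k + p0) * n%:R < \sum_i (b i == k)%:R].
by congr measurable; apply/seteqP; split => x /=; rewrite type_countE.
Qed.

Lemma measurable_sample (B : set (n.-tuple R)) : measurable B ->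
  measurable (sample X @^-1` B).
Proof.
move=> mB; rewrite -[X in measurable X]setTI.
have mX : measurable_fun setT (sample X).
  apply/measurable_fun_tnthP => i.
  apply: (eq_measurable_fun (X i)) => [w _|]; first by rewrite /= tnth_mktuple.
  exact: measurable_funP.
exact: mX.
Qed.

Lemma edges_prob_ge0 w g : 0 <= edges_prob W (sample X w) g.
Proof.
apply: prodr_ge0 => q _; rewrite !tnth_mktuple.
have /andP[W0 W1] := graphon_itv W_graphon (rg_unit G_law q.1 w) (rg_unit G_law q.2 w).
by case: ifP => _; rewrite ?subr_ge0.
Qed.

Lemma measurable_edges_prob (E : set T) g :
  measurable_fun E (fun w => edges_prob W (sample X w) g).
Proof.
apply: (@measurable_funS _ _ _ _ setT) => //.
have mW (q : 'I_n * 'I_n) : measurable_fun setT (fun w => W (X q.1 w) (X q.2 w)).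
  apply: (@measurable_comp _ _ _ _ _ _ (`[0, 1] `*` `[0, 1] : set (R * R))
    (fun q => W q.1 q.2) setT (fun w => (X q.1 w, X q.2 w))).
  - exact: measurableX.
  - by move=> _ [w _ <-]; split; apply: (rg_unit G_law).
  - by case: W_graphon.
  - by apply: measurable_fun_pair; apply: measurable_funP.
rewrite /edges_prob; under eq_fun do rewrite big_mkcond /=.
apply: measurable_prod => q _; case: (q.1 < q.2)%N => //.
apply: (eq_measurable_fun (fun w => if adj g q.1 q.2 then W (X q.1 w) (X q.2 w)
  else 1 - W (X q.1 w) (X q.2 w))) => [w _|]; first by rewrite !tnth_mktuple.
by case: (adj g q.1 q.2) => //; apply: measurable_funB.
Qed.

Lemma measurable_graph_event (bad : pred (sgraph n)) : measurable [set w | bad (G w)].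
Proof.
have mG (g : {E : {set 'I_n * 'I_n} | is_sgraph E}) : measurable (G @^-1` [set g]).
  exact: (rg_measurable G_law).
exact: (measurable_preimage_types mG [set g | bad g]).
Qed.

(** Being typical depends on the sample alone, so [rg_conditional] applies with this event for each
    graph; summing over the bad graphs puts a finite Bernoulli expectation under the integral. *)
Lemma probability_typical_bad (bad : pred (sgraph n)) (eta : R) :
  (forall w, typical (sample X w) ->
     expect (fun q => W (X q.1 w) (X q.2 w)) (fun e => (bad (graph_of e))%:R) <= eta) ->
  0 <= eta ->
  (P (sample X @^-1` typical `&` [set w | bad (G w)]) <= eta%:E)%E.
Proof.
move=> Heta eta0; set E := sample X @^-1` typical.
have mE : measurable E by apply: measurable_sample; exact: measurable_typical.
have mG (g : {E : {set 'I_n * 'I_n} | is_sgraph E}) : measurable (G @^-1` [set g]).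
  exact: (rg_measurable G_law).
rewrite (measure_types P bad mE mG).
have -> : (\sum_(g : {E : {set 'I_n * 'I_n} | is_sgraph E} | bad g) P (E `&` G @^-1` [set g]) =
    \int[P]_(w in E) \sum_(g : {E : {set 'I_n * 'I_n} | is_sgraph E} | bad g)
      (edges_prob W (sample X w) g)%:E)%E.
  under [RHS]eq_integral do rewrite big_mkcond /=.
  rewrite ge0_integral_sum //.
  - rewrite big_mkcond; apply: eq_bigr => g _; case: (bad g); last by rewrite integral0.
    by rewrite (rg_conditional G_law) //; exact: measurable_typical.
  - move=> g; case: (bad g) => //; apply/measurable_EFinP; exact: measurable_edges_prob.
  - by move=> g w _; case: (bad g) => //; rewrite lee_fin edges_prob_ge0.
apply: (@le_trans _ _ (\int[P]_(w in E) eta%:E)%E).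
  apply: ge0_le_integral => //.
  - by move=> w _; apply: sume_ge0 => g _; rewrite lee_fin edges_prob_ge0.
  - under eq_fun do rewrite big_mkcond /=.
    apply: emeasurable_sum => g; case: (bad g) => //.
    by apply/measurable_EFinP; exact: measurable_edges_prob.
  move=> w Ew; rewrite sumEFin lee_fin sum_edges_prob.
  apply: le_trans (Heta w Ew); rewrite le_eqVlt; apply/orP; left; apply/eqP.
  by congr (expect _ _); apply/funext => q; rewrite !tnth_mktuple.
rewrite integral_cst // -[leRHS]mule1 lee_wpmul2l ?lee_fin //.
exact: probability_le1.
Qed.

Lemma probability_bad (bad : pred (sgraph n)) (eta : R) :
  (forall w, typical (sample X w) ->
     expect (fun q => W (X q.1 w) (X q.2 w)) (fun e => (bad (graph_of e))%:R) <= eta) ->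
  0 <= eta ->
  (P [set w | bad (G w)] <=
   (eta + #|K|%:R * expR (- (Num.min 1 (p0 / 2) * (p0 / 2) * n%:R)))%:E)%E.
Proof.
move=> Heta eta0; set t := expR _.
(* Index set of the union bound: one event for a typical sample with a bad graph, and one for each
   over-represented type. *)
pose F (o : ('I_1 + K)%type) : set T := if o is inr k
  then sample X @^-1` [set x | (p k + p0) * n%:R < type_count x k]
  else sample X @^-1` typical `&` [set w | bad (G w)].
have mF o : measurable (F o).
  case: o => [_|k] /=; last by apply: measurable_sample; exact: measurable_atypical.
  apply: measurableI; last exact: measurable_graph_event.
  by apply: measurable_sample; exact: measurable_typical.
have cover : [set w | bad (G w)] `<=` \bigcup_o F o.
  move=> w bw; have [tw|] := pselect (typical (sample X w)); first by exists (inl ord0).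
  move=> /existsNP[k /negP]; rewrite -ltNge => kw.
  by exists (inr k).
apply: le_trans (measure_union_le P (measurable_graph_event bad) mF cover) _.
rewrite big_sumType big_ord1 /= EFinD leeD ?probability_typical_bad //.
apply: (@le_trans _ _ (\sum_(k : K) t%:E)%E).
  by apply: lee_sum => k _; apply: probability_type_count.
by rewrite sumEFin sumr_const mulr_natl.
Qed.

End Sampling.

Lemma card_of_type_sample (d : measure_display) (T : measurableType d) (R : realType)
    (P : probability T R) (n : nat) (X : 'I_n -> {RV P >-> R}) (K : finType)
    (tau : R -> K) k w :
  #|of_type (fun i => tau (X i w)) k (finset.setT)|%:R = type_count tau (sample X w) k :> R.
Proof.
rewrite /type_count -sum1_card natr_sum big_mkcond; apply: eq_bigr => i _.
by rewrite !inE tnth_mktuple; case: (_ == _).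
Qed.

(** The four constants ph + eps/4, ph + eps/2, ph + 3 eps/4 and ph + eps are equally spaced, and the
    failure probability [eta] is shared equally between the graph and the type counts. *)
Lemma near_probability_bad (R : realType) (W : R -> R -> R)
    (d : nat -> measure_display) (T : forall n : nat, measurableType (d n))
    (P : forall n : nat, probability (T n) R)
    (X : forall n : nat, 'I_n -> {RV (P n) >-> R})
    (G : forall n : nat, T n -> sgraph n) (ph eps eta : R) :
  graphon W -> riemann_integrable W ->
  sup [set W x y | x in `[0, 1] & y in `[0, 1]] < 1 ->
  (forall n : nat, is_random_graph W (X n) (G n)) ->
  phi W = ph%:E -> 0 < eps -> 0 < eta ->
  \forall n \near \oo,
  (P n [set w | ((ph + eps) * n%:R / (2 * ln n%:R) <
                 (chromatic_number (G n w))%:R)%R] <= eta%:E)%E.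
Proof.
move=> W_graphon W_riemann W_lt1 G_law phE eps0 eta0.
have ph0 : 0 <= ph by rewrite -lee_fin -phE phi_ge0.
have [|K [tau [c [p [C [p0 [mtau c_sym c_itv [Wc mup p00 quad]]]]]]]] :=
  @type_approximation R W W_graphon W_lt1 W_riemann ph (eps / 4) phE.
  by rewrite divr_gt0.
have c0 j k : 0 <= c j k by case/andP: (c_itv j k).
have cC j k : c j k <= C by case/andP: (c_itv j k).
have p_ge k : p0 <= p k + p0 by rewrite lerDr -lee_fin -mup.
have eta2 : 0 < eta / 2 by rewrite divr_gt0.
have Phi0_ge0 : 0 <= ph + eps / 4 by lra.
have Phi01 : ph + eps / 4 < ph + eps / 2 by lra.
have Phi12 : ph + eps / 2 < ph + 3 / 4 * eps by lra.
have Phi23 : ph + 3 / 4 * eps < ph + eps by lra.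
have chrom := near_expect_chromatic_le c_sym c0 cC p00 p_ge Phi0_ge0 Phi01 Phi12 Phi23 quad eta2.
pose b := Num.min 1 (p0 / 2) * (p0 / 2).
have b0 : 0 < b by rewrite mulr_gt0 ?lt_min ?ltr01 ?divr_gt0.
have small : \forall n \near \oo, #|K|%:R / (eta / 2) / b <= n%:R :> R.
  exact: nbhs_infty_ger.
apply: filterS2 chrom small => n chrom.
rewrite !ler_pdivrMr // => nb.
have small : #|K|%:R * expR (- (b * n%:R)) <= eta / 2.
  rewrite expRN -ler_pdivlMr ?invr_gt0 ?expR_gt0 // invrK.
  apply: le_trans nb _; rewrite mulrC ler_wpM2l ?(ltW eta2) // mulrC.
  by apply: le_trans (expR_ge1Dx _); rewrite lerDr.
have unit_itv i w : X n i w \in `[0, 1] by apply: (rg_unit (G_law n)).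
have Xlt1 i j w : 0 <= W (X n i w) (X n j w) < 1.
  have /andP[-> W1] := graphon_le_sup W_graphon (unit_itv i w) (unit_itv j w).
  exact: le_lt_trans W_lt1.
have typ_le w : typical tau p p0 (sample (X n) w) ->
    expect (fun q => W (X n q.1 w) (X n q.2 w)) (fun e =>
      ((ph + eps) * n%:R / (2 * ln n%:R) < (chromatic_number (graph_of e))%:R)%R%:R)
    <= eta / 2.
  move=> typ; have Wc' (q : 'I_n * 'I_n) : (q.1 < q.2)%N ->
      expR (- c (tau (X n q.1 w)) (tau (X n q.2 w))) <= 1 - W (X n q.1 w) (X n q.2 w).
    by move=> _; apply: Wc.
  have typ' k : #|of_type (fun i => tau (X n i w)) k (finset.setT)|%:R <= (p k + p0) * n%:R.
    by rewrite card_of_type_sample; apply: typ.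
  exact: (chrom (fun i => tau (X n i w)) (fun q => W (X n q.1 w) (X n q.2 w))).
have := probability_bad (G_law n) W_graphon mtau mup p00
  (bad := fun g => (ph + eps) * n%:R / (2 * ln n%:R) < (chromatic_number g)%:R)
  typ_le (ltW eta2).
move=> /le_trans; apply.
by rewrite lee_fin -/b; lra.
Qed.

Unset Implicit Arguments.

Theorem theorem2p1 (R : realType) (W : R -> R -> R)
    (W_graphon : graphon W)
    (W_riemann : riemann_integrable W)
    (W_lt1 : sup [set W x y | x in `[0, 1] & y in `[0, 1]] < 1)
    (d : nat -> measure_display)
    (T : forall n : nat, measurableType (d n))
    (P : forall n : nat, probability (T n) R)
    (X : forall n : nat, 'I_n -> {RV (P n) >-> R})
    (G : forall n : nat, T n -> sgraph n)
    (G_law : forall n : nat, is_random_graph W (X n) (G n))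
    (eps : R) (eps_gt0 : 0 < eps) :
  P n [set w | ((chromatic_number (G n w))%:R%:E <=
                (phi W + eps%:E) * (n%:R / (2 * ln n%:R))%:E)%E]
    @[n --> \oo] --> 1%E.
Proof.
have ln_gt0' : \forall n \near \oo, 0 < n%:R / (2 * ln n%:R) :> R.
  near=> n; have n1 : 1 < n%:R :> R by near: n; exact: nbhs_infty_gtr.
  by rewrite divr_gt0 ?mulr_gt0 ?ln_gt0 // (lt_trans ltr01).
case phE : (phi W) => [ph| |]; last 2 first.
(* With an infinite supremum the bound is infinite as soon as n/(2 ln n) is positive, so the event
   is certain. *)
- apply: cvg_near_cst; near=> n.
  have n0 : 0 < n%:R / (2 * ln n%:R) :> R by near: n.
  rewrite (_ : [set w | _] = setT) ?probability_setT //.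
  apply/seteqP; split=> // w _ /=.
  by rewrite addye // mulyr gtr0_sg // mul1e leey.
- by have := phi_ge0 W_graphon W_lt1; rewrite phE.
have mbad n : measurable [set w | (ph + eps) * n%:R / (2 * ln n%:R) <
    (chromatic_number (G n w))%:R].
  exact: (measurable_graph_event (G_law n)
    (fun g => (ph + eps) * n%:R / (2 * ln n%:R) < (chromatic_number g)%:R)).
have PE n : P n [set w | ((chromatic_number (G n w))%:R%:E <=
      (ph%:E + eps%:E) * (n%:R / (2 * ln n%:R))%:E)%E] =
    (1 - P n [set w | ((ph + eps) * n%:R / (2 * ln n%:R) < (chromatic_number (G n w))%:R)%R])%E.
  rewrite -probability_setC //; congr (P n _); apply/seteqP; split => w /=;
  by rewrite -EFinD -EFinM lee_fin mulrA leNgt => /negP.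
have Pfin n : P n [set w | (ph + eps) * n%:R / (2 * ln n%:R) <
   (chromatic_number (G n w))%:R] \is a fin_num by apply: fin_num_measure.
under eq_cvg do rewrite PE.
apply: cvg_EFin; first by near=> n; rewrite fin_numB Pfin.
apply/cvgrPdist_le => e e0 /=.
have := near_probability_bad W_graphon W_riemann W_lt1 G_law phE eps_gt0 e0.
apply: filterS => n Pe.
rewrite fineB ?Pfin //= opprB addrCA subrr addr0 ger0_norm ?fine_ge0 //.
by rewrite -lee_fin fineK.
Unshelve. all: by end_near.
Qed.
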